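(* Let $Q=[0,1]^2$ and let $u:Q\to\mathbb R$ be a continuous function with finite relaxed energy $\mathcal E(u,Q)<\infty$. Let $$M_u:=\begin{pmatrix}\partial_1\nu_u^1&\partial_2\nu_u^1\\ \partial_1\nu_u^2&\partial_2\nu_u^2\\ \partial_1\nu_u^3&\partial_2\nu_u^3\end{pmatrix}$$ be the matrix of the approximate partial derivatives of the unit normal $\nu_u=(\nu_u^1,\nu_u^2,\nu_u^3)$. If $u$ is strictly convex (or strictly concave), then all the $2\times2$-minors of the matrix $M_u$ are in $L^1(Q)$.
   Context: A polyhedral surface $P$ is inscribed in the graph of $u$ if there is a finite triangulation $\mathcal D$ of $Q$ such that $P=P(u,\mathcal D)$ is the graph of the continuous function that is affine on each triangle of $\mathcal D$ and agrees with $u$ on the vertices of $\mathcal D$. The mesh of $\mathcal D$ is the supremum of the diameters of its triangles. The total energy of $P$ is $\mathcal E(P):=A(P)+\mathcal E_{\mathbf H}(P)+\mathcal E_{\mathbf K}(P)$, where $A(P)$ is the area; $\mathcal E_{\mathbf H}(P):=\sum_e\mathcal L(e)\cdot2\sin(\theta_e/2)$, sum over the edges $e$ of $P$ (shared by two faces), with $\mathcal L(e)$ the length and $\theta_e$ the exterior dihedral angle along $e$ (angle between the unit normals of the two faces); $\mathcal E_{\mathbf K}(P):=\sum_V|\mathbf K_P(V)|$, sum over the (interior) vertices, with $\mathbf K_P(V):=2\pi-\sum_i\theta_i$, $\theta_i$ the angle at $V$ of the $i$-th triangle meeting at $V$. The relaxed energy is $\mathcal E(u,Q):=\inf\{\liminf_{h\to\infty}\mathcal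 E(P_h)\}$, infimum among all sequences of inscribed polyhedral surfaces $P_h=P(u,\mathcal D_h)$ with $\mathrm{mesh}\,\mathcal D_h\to0$. If $\mathcal E(u,Q)<\infty$ then $u\in\mathrm{BV}(Q)$ and the unit normal $\nu_u:=g_u^{-1/2}(-\partial_1u,-\partial_2u,1)$, $g_u:=1+|\nabla u|^2$ (defined a.e. via the approximate partial derivatives of $u$), belongs to $\mathrm{BV}(Q,\mathbb R^3)$, so its approximate partial derivatives exist a.e. *)

(* Defs.v *)
From HB Require Import structures.
From mathcomp Require Import all_boot all_order all_algebra.
From mathcomp Require Import finmap.
From mathcomp Require Import all_classical all_reals all_analysis.

Set Implicit Arguments.
Unset Strict Implicit.
Unset Printing Implicit Defensive.

Import Order.TTheory GRing.Theory Num.Theory.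
Import numFieldNormedType.Exports.

Local Open Scope classical_set_scope.
Local Open Scope ring_scope.

(** Euclidean geometry.  The norm that the library puts on products and on
    matrices is the sup norm, so the Euclidean one is defined here. *)
Section Euclid.
Context {R : realType}.
Implicit Types (x y : R * R) (n : nat).

Definition dist2 x y : R := Num.sqrt ((x.1 - y.1) ^+ 2 + (x.2 - y.2) ^+ 2).

Definition dotv n (v w : 'rV[R]_n) : R := \sum_(i < n) v 0 i * w 0 i.

Definition normv n (v : 'rV[R]_n) : R := Num.sqrt (dotv v v).

Definition anglev n (v w : 'rV[R]_n) : R :=
  acos (dotv v w / (normv v * normv w)).

Definition vec3 (a b c : R) : 'rV[R]_3 := \row_(i < 3) [:: a; b; c]`_i.

Definition crossv (v w : 'rV[R]_3) : 'rV[R]_3 :=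
  let v_ k := v 0 (inord k) in let w_ k := w 0 (inord k) in
  vec3 (v_ 1%N * w_ 2%N - v_ 2%N * w_ 1%N)
       (v_ 2%N * w_ 0%N - v_ 0%N * w_ 2%N)
       (v_ 0%N * w_ 1%N - v_ 1%N * w_ 0%N).

Definition hull (A : {fset R * R}) : set (R * R) :=
  [set x | exists w : R * R -> R,
    [/\ (forall v, v \in A -> 0 <= w v),
        \sum_(v <- A) w v = 1,
        x.1 = \sum_(v <- A) w v * v.1 &
        x.2 = \sum_(v <- A) w v * v.2]].

Definition diameter (A : set (R * R)) : R :=
  sup [set dist2 p.1 p.2 | p in A `*` A].

End Euclid.

Section Energy.
Context {R : realType}.

Definition Q : set (R * R) := `[0, 1]%classic `*` `[0, 1]%classic.

(** A triangle is given by the finite set of its vertices, a triangulation by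
    the finite set of its triangles. *)
Definition triangle : Type := {fset R * R}.

Definition nondegenerate_triangle (T : triangle) : Prop :=
  #|` T|%fset = 3%N /\
  ((T`_1).1 - (T`_0).1) * ((T`_2).2 - (T`_0).2)
    - ((T`_1).2 - (T`_0).2) * ((T`_2).1 - (T`_0).1) != 0.

(** As [hull fset0] is empty, the last clause says that two triangles are
    disjoint or meet exactly in a common vertex or a common edge. *)
Definition is_triangulation (D : {fset triangle}) : Prop :=
  [/\ (forall T, T \in D -> nondegenerate_triangle T),
      \bigcup_(T in [set` D]) hull T = Q &
      forall T T', T \in D -> T' \in D ->
        hull T `&` hull T' = hull (T `&` T')%fset].

Definition mesh (D : {fset triangle}) : R :=
  sup [set diameter (hull T) | T in [set` D]].

Definition vertices (D : {fset triangle}) : {fset R * R} :=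
  (\bigcup_(T <- D) T)%fset.

Definition faces_at (D : {fset triangle}) (e : {fset R * R}) : {fset triangle} :=
  [fset T in D | (e `<=` T)%fset]%fset.

Definition inner_edges (D : {fset triangle}) : {fset {fset R * R}} :=
  [fset e in fpowerset (vertices D)
     | (#|` e| == 2) && (#|` faces_at D e| == 2)]%fset.

(** The polyhedral surface [P(u, D)] has as faces the lifts to the graph of [u]
    of the triangles of [D]. All the quantities below that use the enumeration
    [T`_0, T`_1, T`_2] of a triangle (or [e`_0, e`_1] of an edge) are
    independent of its order. *)
Variable u : R * R -> R.

Definition lift (x : R * R) : 'rV[R]_3 := vec3 x.1 x.2 (u x).

Definition face_cross (T : triangle) : 'rV[R]_3 :=
  crossv (lift T`_1 - lift T`_0) (lift T`_2 - lift T`_0).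

Definition face_area (T : triangle) : R := normv (face_cross T) / 2.

(** The upward unit normal: the sign of the third component of the cross
    product is the orientation of the enumeration. *)
Definition face_normal (T : triangle) : 'rV[R]_3 :=
  (Num.sg (face_cross T 0 (inord 2%N)) / normv (face_cross T)) *: face_cross T.

Definition edge_length (e : {fset R * R}) : R := normv (lift e`_1 - lift e`_0).

Definition dihedral (D : {fset triangle}) (e : {fset R * R}) : R :=
  let F : seq {fset R * R} := faces_at D e in
  anglev (face_normal (nth fset0 F 0%N)) (face_normal (nth fset0 F 1%N)).

Definition face_angle (T : triangle) (V : R * R) : R :=
  let e := (T `\ V)%fset in
  anglev (lift e`_0 - lift V) (lift e`_1 - lift V).

Definition curvature (D : {fset triangle}) (V : R * R) : R :=
  2 * pi - \sum_(T <- D | V \in T) face_angle T V.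

Definition area_energy (D : {fset triangle}) : R := \sum_(T <- D) face_area T.

Definition mean_energy (D : {fset triangle}) : R :=
  \sum_(e <- inner_edges D) edge_length e * (2 * sin (dihedral D e / 2)).

Definition gauss_energy (D : {fset triangle}) : R :=
  \sum_(V <- vertices D | V \in (Q^° : set (R * R))) `|curvature D V|.

Definition energy (D : {fset triangle}) : R :=
  area_energy D + mean_energy D + gauss_energy D.

Definition relaxed_energy : \bar R :=
  ereal_inf [set limn_einf (fun h => (energy (D h))%:E) | D in
    [set D : nat -> {fset triangle} |
      (forall h, is_triangulation (D h)) /\
      (mesh (D h) @[h --> \oo] --> (0 : R))]].

End Energy.

Section Approximate.
Context {R : realType}.

Local Notation mu2 := (@lebesgue_measure R \x @lebesgue_measure R)%E.

Definition disc (x : R * R) (r : R) : set (R * R) := [set y | dist2 x y < r].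

(** The set [E] need not be measurable: the measurable superset [A] makes this
    the density of [E] with respect to the Lebesgue outer measure. *)
Definition density0 (E : set (R * R)) (x : R * R) : Prop :=
  exists A, [/\ measurable A, E `<=` A &
    fine (mu2 (A `&` disc x r)) / fine (mu2 (disc x r)) @[r --> 0^'+] --> (0 : R)].

(** Only the values on [Q] of the functions matter. *)
Definition ap_lim (f : R * R -> R) (x : R * R) (l : R) : Prop :=
  forall eps, 0 < eps -> density0 (Q `&` [set y | eps <= `|f y - l|]) x.

(** [z] is the approximate limit of [f] at [x], so that this does not depend on
    the representative of [f]. *)
Definition ap_differential (f : R * R -> R) (x : R * R) (L : 'rV[R]_2) : Prop :=
  exists z : R, ap_lim f x z /\
    ap_lim (fun y => `|f y - z - (L 0 0 * (y.1 - x.1) + L 0 1 * (y.2 - x.2))|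
                     / dist2 y x) x 0.

(** The row of the approximate partial derivatives, with value [0] at the
    points of approximate non-differentiability. *)
Definition ap_grad (f : R * R -> R) (x : R * R) : 'rV[R]_2 :=
  xget 0 [set L | ap_differential f x L].

Definition unit_normal (u : R * R -> R) (x : R * R) : 'rV[R]_3 :=
  let p := ap_grad u x in
  (Num.sqrt (1 + normv p ^+ 2))^-1 *: vec3 (- p 0 0) (- p 0 1) 1.

Definition normal_jacobian (u : R * R -> R) (x : R * R) : 'M[R]_(3, 2) :=
  \matrix_(i < 3, j < 2) ap_grad (fun y => unit_normal u y 0 i) x 0 j.

(** [measurable] refers to the Borel sets, whence the Borel representative [g]:
    functions in [L^1] are only Lebesgue measurable. *)
Definition L1Q (f : R * R -> R) : Prop :=
  exists2 g : R * R -> R,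
    mu2.-integrable Q (EFin \o g) &
    {ae mu2, forall x, Q x -> f x = g x}.

Definition strictly_convex (u : R * R -> R) : Prop :=
  forall (x y : R * R) (t : R), Q x -> Q y -> x <> y -> 0 < t < 1 ->
    u (t * x.1 + (1 - t) * y.1, t * x.2 + (1 - t) * y.2)
      < t * u x + (1 - t) * u y.

End Approximate.

(* Main.v *)
(** The minors are integrable because the Gauss map takes values in the sphere and
    is injective.  A convex [u] is differentiable almost everywhere, since on each
    line in a coordinate direction there are at most countably many points without
    a derivative, and its gradient is continuous on the set [S] of the points
    where it exists.  For a strictly convex [u] a point [x] of [S] is the unique
    minimum point over [Q] of [u] minus the linear map given by the gradient at
    [x]; so the gradient has a continuous left inverse, and each pair of
    components of the normal has a Borel left inverse once the sign of the third
    component is fixed.  The points where both components are approximately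
    differentiable with a nonzero Jacobian are covered by countably many Borel sets
    on which the pair is close to an invertible affine map.  There the Jacobian
    times the measure of a Borel set is at most a constant times the measure of
    its image, as one sees by comparing two measures on dyadic squares.  The
    images of disjoint pieces are disjoint Borel subsets of a fixed square, and
    summing over the pieces bounds the integral of the minor. *)

(* Only finiteness is at stake, so constants may be lost freely: the preimage of a dyadic square is
   measured through its sections instead of a linear change of variables, and an affine
   approximation may be off by a factor 2. Comparing a push-forward with Lebesgue measure bounds
   preimages rather than images, so no covering argument is run; the image enters only as a Borel
   set, cut out by the left inverse. The work takes place on the set of full measure where the
   gradient exists. The normal is continuous relative to it, so approximate limits there are values
   and only the approximate slope is left to describe. Slopes that fit a function at the same point
   up to small errors are close to each other; this turns the existence of an approximate gradient
   into countably many conditions with rational data and makes it measurable. Where a component has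
   no approximate gradient, [ap_grad] is [0] and the minor vanishes. Convex and concave [u] are
   treated at once, through a sign [s] with [s * s = 1]. *)
From HB Require Import structures.
Require Import Defs.
From mathcomp Require Import all_boot all_order all_algebra.
From mathcomp Require Import all_classical all_reals all_analysis.
From mathcomp Require Import measurable_realfun ring lra.

Set Implicit Arguments.
Unset Strict Implicit.
Unset Printing Implicit Defensive.

Import Order.TTheory GRing.Theory Num.Theory.
Import numFieldNormedType.Exports.

Local Open Scope classical_set_scope.
Local Open Scope ring_scope.

(** * The plane with Lebesgue measure *)

(* The lemmas of the library on [lebesgue_measure] are about [measurableTypeR R],
   whose measurability display is not the one of [R]. *)
Notation plane R := (measurableTypeR R * measurableTypeR R)%type.

(* This alias carries a sigma-finite structure: the one of the library on a
   product of measures is overridden by that of sub-probabilities. *)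
Definition leb2 (R : realType) : set (plane R) -> \bar R :=
  (@lebesgue_measure R \x @lebesgue_measure R)%E.
Arguments leb2 {R}.

HB.instance Definition _ (R : realType) := Measure.on (@leb2 R).

Lemma sigma_finite_leb2 (R : realType) : sigma_finite setT (@leb2 R).
Proof.
exists (fun k => `]- k%:R, k%:R]%classic `*` `]- k%:R, k%:R]%classic).
  rewrite -setXTT -(@bigcup_itvT R false false) predeqE => -[x y]; split.
    move=> [[n _ nx] [k _ ky]]; exists (maxn n k) => //; split.
      move: nx; rewrite /= !in_itv/= => /andP[h1 h2].
      have h : (n%:R <= (maxn n k)%:R :> R) by rewrite ler_nat leq_maxl.
      by apply/andP; split; lra.
    move: ky; rewrite /= !in_itv/= => /andP[h1 h2].
    have h : (k%:R <= (maxn n k)%:R :> R) by rewrite ler_nat leq_maxr.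
    by apply/andP; split; lra.
  by move=> [n _ [/= ? ?]]; split; exists n.
move=> k; split; first exact: measurableX.
have lty : (lebesgue_measure (`](- k%:R)%R, (k%:R)%R]%classic : set R) < +oo)%E.
  by rewrite lebesgue_measure_itv; case: ifP; rewrite -?EFinB ?ltry.
by rewrite /leb2 product_measure1E// lte_mul_pinfty// ge0_fin_numE.
Qed.

HB.instance Definition _ (R : realType) :=
  Measure_isSigmaFinite.Build _ _ _ (@leb2 R) (@sigma_finite_leb2 R).

Section Plane.
Context {R : realType}.
Implicit Types A B : set (plane R).

Lemma measurable_fst2 : @measurable_fun _ _ (plane R) R setT fst.
Proof. exact: measurable_fst. Qed.

Lemma measurable_snd2 : @measurable_fun _ _ (plane R) R setT snd.
Proof. exact: measurable_snd. Qed.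

Lemma measurable_plane_ball (x : R * R) (r : R) : measurable (ball x r : set (plane R)).
Proof.
rewrite (_ : ball x r = ball x.1 r `*` ball x.2 r) //.
by apply: measurableX; exact: measurable_ball.
Qed.

Lemma leb2X (A B : set (measurableTypeR R)) : measurable A -> measurable B ->
  leb2 (A `*` B) = (lebesgue_measure A * lebesgue_measure B)%E.
Proof. exact: product_measure1E. Qed.

Lemma leb2_ball (x : R * R) (r : R) : 0 <= r -> leb2 (ball x r) = (4 * r ^+ 2)%:E.
Proof.
move=> r0; rewrite (_ : ball x r = ball x.1 r `*` ball x.2 r) //.
rewrite leb2X; [|exact: measurable_ball..].
by rewrite !lebesgue_measure_ball// -EFinM; congr EFin; ring.
Qed.

(** Measurable sets are generated by rectangles, so the open set is exhausted by the countably many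
    sup-norm balls inside it with rational centre and radius [n.+1%:R^-1]. *)
Lemma open_measurable_plane A : open (A : set (R * R)) -> measurable A.
Proof.
move=> oA.
pose q (n : nat) : (rat * rat) * nat := odflt ((0, 0), 0%N) (unpickle n).
pose c (n : nat) : R * R := (ratr (q n).1.1, ratr (q n).1.2).
pose B (n : nat) : set (plane R) :=
  if `[< ball (c n) ((q n).2.+1%:R^-1) `<=` A >]
  then ball (c n) ((q n).2.+1%:R^-1) else set0.
rewrite (_ : A = \bigcup_n B n); last first.
  apply/seteqP; split=> [x Ax|x [n _]]; last first.
    by rewrite /B; case: asboolP => // h; exact: h.
  have /nbhs_ballP[e /= e0 eA] := open_nbhs_nbhs (conj oA Ax).
  (* A ball of radius [d < e / 2] whose centre is within [d] of [x] stays in the ball of radius [e]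
     around [x]. *)
  have e20 : 0 < e / 2 by rewrite divr_gt0.
  have [n _ /(_ n (leqnn n)) /= nlt] := near_infty_natSinv_lt (PosNum e20).
  have : 0 < n.+1%:R^-1 :> R by rewrite invr_gt0.
  set d := n.+1%:R^-1 in nlt * => n0.
  have /rat_in_itvoo[p] : x.1 - d < x.1 + d by lra.
  rewrite in_itv/= => /andP[p1 p2].
  have /rat_in_itvoo[p'] : x.2 - d < x.2 + d by lra.
  rewrite in_itv/= => /andP[p1' p2'].
  exists (pickle ((p, p'), n)) => //.
  rewrite /B /c /q pickleK/= -/d.
  case: asboolP => [_|[]].
    by split; rewrite /ball/= ltr_norml; apply/andP; split; lra.
  move=> y [/= y1 y2]; apply: eA; split; rewrite /ball/=.
    move: y1; rewrite /ball/= !ltr_norml => /andP[? ?]; apply/andP; split; lra.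
  move: y2; rewrite /ball/= !ltr_norml => /andP[? ?]; apply/andP; split; lra.
apply: bigcupT_measurable => n; rewrite /B; case: asboolP => // _.
exact: measurable_plane_ball.
Qed.

Lemma leb_itv_center (c l : R) : 0 <= l ->
  lebesgue_measure (`[c - l, c + l]%classic : set R) = (2 * l)%:E.
Proof.
move=> l0; rewrite lebesgue_measure_itv/= lte_fin.
by case: ltP => h; rewrite ?EFinN -?EFinB; congr EFin; lra.
Qed.

(** By Fubini: a vertical section lies within [l] of any one of its points, hence in an interval of
    length [2 * l], and it is empty unless the abscissa lies in an interval of length [2 * h]. *)
Lemma leb2_le_sections A (c h l : R) : measurable A -> 0 <= h -> 0 <= l ->
    (forall x, A x -> `|x.1 - c| <= h) ->
    (forall x y, A x -> A y -> x.1 = y.1 -> `|x.2 - y.2| <= l) ->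
  (leb2 A <= (4 * h * l)%:E)%E.
Proof.
move=> mA h0 l0 Ah Al; rewrite /leb2 /product_measure1.
pose J : set (measurableTypeR R) := `[c - h, c + h]%classic.
have mJ : measurable_fun setT (fun x => (\1_J x : R)%:E).
  by apply/measurable_EFinP/measurable_indic; exact: measurable_itv.
have sec (x : measurableTypeR R) : (lebesgue_measure (xsection A x) <= (2 * l)%:E * (\1_J x)%:E)%E.
  have [[y Ay]|nA] := pselect (exists y, A (x, y)); last first.
    rewrite (_ : xsection A x = set0) ?measure0.
      by rewrite mule_ge0// lee_fin ?mulr_ge0.
    by rewrite -subset0 => y; rewrite /xsection/= inE => Ay; apply: nA; exists y.
  have -> : \1_J x = 1 :> R.
    rewrite indicE mem_set// /J/= in_itv/=.
    by have := Ah _ Ay; rewrite /= ler_norml => /andP[? ?]; apply/andP; split; lra.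
  rewrite mule1.
  have sub : xsection A x `<=` `[y - l, y + l]%classic.
    move=> z; rewrite /xsection/= inE in_itv/= => Az.
    have := Al _ _ Az Ay erefl; rewrite /= ler_norml => /andP[? ?].
    by apply/andP; split; lra.
  apply: (le_trans (le_measure _ _ _ sub)); rewrite ?inE//.
    exact: measurable_xsection.
  by rewrite [leLHS](leb_itv_center _ l0).
apply: (@le_trans _ _ (\int[lebesgue_measure]_x ((2 * l)%:E * (\1_J x)%:E))%E).
  apply: ge0_le_integral => //.
  - exact: (measurable_fun_xsection (@lebesgue_measure R)).
  - exact: measurable_funeM.
  - by move=> x _; exact: sec.
rewrite ge0_integralZl//; last by rewrite lee_fin mulr_ge0.
rewrite integral_indic//; last exact: measurable_itv.
rewrite [X in (_ * X)%E](_ : _ = (2 * h)%:E); last first.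
  by rewrite -(leb_itv_center c h0); congr (lebesgue_measure _); exact: setIT.
by rewrite -EFinM lee_fin; lra.
Qed.

Lemma leb2_xsection0 A : measurable A ->
  (forall x : R, lebesgue_measure (xsection A x) = 0%E) -> leb2 A = 0%E.
Proof.
by move=> mA A0; rewrite /leb2 /product_measure1; apply: integral0_eq => x _; exact: A0.
Qed.

Lemma leb2_ysection0 A : measurable A ->
  (forall y : R, lebesgue_measure (ysection A y) = 0%E) -> leb2 A = 0%E.
Proof.
move=> mA A0; rewrite /leb2 (@product_measure_unique _ _ _ _ _ _ _
  (product_measure2 (@lebesgue_measure R) (@lebesgue_measure R)))//.
  by rewrite /product_measure2; apply: integral0_eq => y _; exact: A0.
by move=> B C mB mC; exact: product_measure2E.
Qed.

Lemma le_leb2 A B : measurable A -> measurable B -> A `<=` B -> (leb2 A <= leb2 B)%E.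
Proof. by move=> mA mB AB; apply: le_measure; rewrite ?inE. Qed.

End Plane.

(** * Comparison of measures on dyadic squares *)

Section Dyadic.
Local Notation floor := Num.floor.
Context {R : realType}.
Implicit Types A B : set (plane R).

Definition dyadic_index (n : nat) (x : R * R) : int * int :=
  (floor (2 ^+ n * x.1), floor (2 ^+ n * x.2)).

Definition dyadic_square n (z : int * int) : set (plane R) :=
  [set x | dyadic_index n x = z].

Lemma floor_half (s t : R) : floor (2 * t) = floor (2 * s) -> floor t = floor s.
Proof.
suff le (a b : R) : floor (2 * a) = floor (2 * b) -> floor a <= floor b.
  by move=> st; apply/eqP; rewrite eq_le !le.
move=> ab.
have := floor_itv a => /andP[a1 a2]; have := floor_itv (2 * b) => /andP[b1 b2].
rewrite floor_ge_int.
have : floor a * 2 <= floor (2 * a) by rewrite floor_ge_int intrM; lra.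
rewrite ab -(ler_int R) intrM => h.
lra.
Qed.

Lemma dyadic_index_le n m (x y : R * R) : (n <= m)%N ->
  dyadic_index m x = dyadic_index m y -> dyadic_index n x = dyadic_index n y.
Proof.
move=> /subnK <-; elim: (m - n)%N => // k IH [h1 h2]; apply: IH.
by move: h1 h2; rewrite addSn exprS -!mulrA => /floor_half e1 /floor_half e2;
  congr pair.
Qed.

Lemma floor_dist n (t t' : R) :
  floor (2 ^+ n * t) = floor (2 ^+ n * t') -> `|t - t'| <= (2 ^+ n)^-1.
Proof.
move=> tt; have n0 : 0 < 2 ^+ n :> R by rewrite exprn_gt0.
rewrite -(ler_pM2l n0) divff ?gt_eqF// -[X in X * `|_|]gtr0_norm// -normrM.
rewrite mulrBr ler_norml.
have /andP[h1 h2] := floor_itv (2 ^+ n * t).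
have /andP[h3 h4] := floor_itv (2 ^+ n * t').
move: h1 h2; rewrite tt; move: h3 h4; rewrite intrD => ? ? ? ?.
by apply/andP; split; lra.
Qed.

Lemma dyadic_squareE n (z : int * int) : dyadic_square n z =
  `[z.1%:~R / 2 ^+ n, (z.1 + 1)%:~R / 2 ^+ n[%classic
  `*` `[z.2%:~R / 2 ^+ n, (z.2 + 1)%:~R / 2 ^+ n[%classic.
Proof.
have n0 : 0 < 2 ^+ n :> R by rewrite exprn_gt0.
apply/seteqP; split => [x <-|x [/=]].
  have /andP[? ?] := floor_itv (2 ^+ n * x.1).
  have /andP[? ?] := floor_itv (2 ^+ n * x.2).
  by split; rewrite /= in_itv/= ler_pdivrMr// ltr_pdivlMr// ![_ * 2 ^+ n]mulrC;
    apply/andP.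
rewrite !in_itv/= !ler_pdivrMr// !ltr_pdivlMr// ![_ * 2 ^+ n]mulrC => h1 h2.
rewrite /dyadic_square /dyadic_index/= [LHS]surjective_pairing/=.
by rewrite (floor_def h1) (floor_def h2) -surjective_pairing.
Qed.

Lemma measurable_dyadic_square n z : measurable (dyadic_square n z).
Proof. by rewrite dyadic_squareE; apply: measurableX; exact: measurable_itv. Qed.

Lemma leb2_dyadic_square n z : leb2 (dyadic_square n z) = ((2 ^+ n)^-1 ^+ 2)%:E.
Proof.
have n0 : 0 < 2 ^+ n :> R by rewrite exprn_gt0.
rewrite dyadic_squareE leb2X; [|exact: measurable_itv..].
have len (i : int) : lebesgue_measure
    (`[i%:~R / 2 ^+ n, (i + 1)%:~R / 2 ^+ n[%classic : set R) = (2 ^+ n)^-1%:E.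
  rewrite lebesgue_measure_itv/= lte_fin ltr_pM2r ?invr_gt0// ltr_int ltzD1 lexx.
  by rewrite -EFinB intrD; congr EFin; rewrite mulrDl mul1r addrC addKr.
by rewrite !len -EFinM -expr2.
Qed.

(** The unions of dyadic squares of a single generation. Stated as invariance under equality of
    indices, closure under the set operations only needs a passage to the finer of two
    generations. *)
Definition dyadic_ring : set (set (plane R)) :=
  [set A | exists n, forall x y, dyadic_index n x = dyadic_index n y -> A x -> A y].

Lemma setring_dyadic : setring dyadic_ring.
Proof.
split=> [|A B [n hA] [m hB]|A B [n hA] [m hB]]; first by exists 0%N.
  exists (maxn n m) => x y h [Ax|Bx]; [left|right].
    by apply: hA Ax; apply: dyadic_index_le h; exact: leq_maxl.
  by apply: hB Bx; apply: dyadic_index_le h; exact: leq_maxr.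
exists (maxn n m) => x y h [Ax Bx]; split.
  by apply: hA Ax; apply: dyadic_index_le h; exact: leq_maxl.
by apply: contra_not Bx; apply: hB; apply: dyadic_index_le (esym h); exact: leq_maxr.
Qed.

Lemma dyadic_ring_generates : @measurable _ (plane R) `<=` <<sr dyadic_ring>>.
Proof.
have [S0 SD SU] := @smallest_sigma_ring _ dyadic_ring.
have ST : <<sr dyadic_ring>> setT by apply: sub_g_sigma_ring; exists 0%N.
have SI A B : <<sr dyadic_ring>> A -> <<sr dyadic_ring>> B -> <<sr dyadic_ring>> (A `&` B).
  by move=> hA hB; rewrite -setDD; apply: (SD) => //; exact: SD.
have approx (p : R * R -> R) :
    (forall n x y, dyadic_index n x = dyadic_index n y ->
      floor (2 ^+ n * p x) = floor (2 ^+ n * p y)) ->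
    forall C : set R, measurable C -> <<sr dyadic_ring>> (p @^-1` C).
  move=> hp C mC.
  have {}mC : <<s @RGenInftyO.G R>> C by have := mC; rewrite [X in X C](RGenInftyO.measurableE R).
  apply: (mC [set C | <<sr dyadic_ring>> (p @^-1` C)]); split.
  - split=> [|D hD|F hF] /=.
    + by rewrite preimage_set0.
    + by rewrite setTD preimage_setC -setTD; exact: SD.
    + by rewrite preimage_bigcup; exact: SU.
  - move=> _ [a ->] /=.
    (* A value lies below [a] exactly when, for some [n], the right end of its dyadic interval of
       generation [n] is at most [a]. *)
    rewrite (_ : _ @^-1` _ = \bigcup_n
        [set x | (floor (2 ^+ n * p x) + 1)%:~R <= 2 ^+ n * a]).
      apply: SU => n; apply: sub_g_sigma_ring; exists n => x y /hp h /=.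
      by rewrite h.
    apply/seteqP; split=> [x|x [n _]] /=; rewrite in_itv/=; last first.
      have /andP[_ h2] := floor_itv (2 ^+ n * p x).
      have n0 : 0 < 2 ^+ n :> R by rewrite exprn_gt0.
      by move=> h; rewrite -(ltr_pM2l n0); lra.
    rewrite -subr_gt0 => h.
    have [n _ /(_ n (leqnn n)) /= nlt] := near_infty_natSinv_lt (PosNum h).
    exists n => //=.
    have /andP[h1 _] := floor_itv (2 ^+ n * p x).
    rewrite intrD.
    have n0 : 0 < n.+1%:R :> R by [].
    have n2 : n.+1%:R <= 2 ^+ n :> R by rewrite -natrX ler_nat ltn_expl.
    have : 1 < 2 ^+ n * (a - p x).
      apply: (@lt_le_trans _ _ (n.+1%:R * (a - p x))).
        by rewrite mulrC -ltr_pdivrMr// div1r.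
      by rewrite ler_pM2r.
    lra.
rewrite measurable_prod_measurableType => A; apply; split.
  by split=> // A' hA'; exact: SD.
move=> _ [B mB [C mC <-]].
rewrite (_ : _ `*` _ = (fst @^-1` B) `&` (snd @^-1` C)) //.
by apply: SI; apply: approx => // n x y [].
Qed.

(** On [dyadic_ring] the inequality follows by countable additivity, a member being a countable
    disjoint union of squares. It passes to monotone limits, the decreasing ones by finiteness of
    the total masses, and the monotone class theorem for rings then reaches every Borel set. *)
Lemma measure_le_dyadic (nu mu : {measure set (plane R) -> \bar R}) (K : R) :
    (nu setT < +oo)%E -> (mu setT < +oo)%E -> 0 <= K ->
    (forall n z, (nu (dyadic_square n z) <= K%:E * mu (dyadic_square n z))%E) ->
  forall A, measurable A -> (nu A <= K%:E * mu A)%E.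
Proof.
move=> nufin mufin K0 numu.
have fin_lty (m : {measure set (plane R) -> \bar R}) A :
    (m setT < +oo)%E -> measurable A -> (m A < +oo)%E.
  by move=> mT mA; apply: le_lt_trans mT; apply: le_measure; rewrite ?inE.
pose G : set (set (plane R)) := [set A | measurable A /\ (nu A <= K%:E * mu A)%E].
suff : <<sr dyadic_ring>> `<=` G.
  by move=> h A /dyadic_ring_generates /h[].
apply: monotone_setring_sub_g_sigma_ring; last 2 first.
- exact: setring_dyadic.
- move=> A [n hA].
  pose D (k : nat) : set (plane R) :=
    if @pickle_inv (int * int)%type k is Some z then A `&` dyadic_square n z else set0.
  have DE k : D k = set0 \/ exists2 z, @pickle_inv (int * int)%type k = Some z & D k = dyadic_square n z.
    rewrite /D; case: (@pickle_inv (int * int)%type k) => [z|]; last by left.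
    have [[x [Ax xz]]|h] := pselect (exists x, (A `&` dyadic_square n z) x).
      right; exists z => //; apply/seteqP; split=> [y []//|y yz]; split=> //.
      by apply: hA Ax; rewrite xz yz.
    by left; rewrite -subset0 => y hy; apply: h; exists y.
  have mD k : measurable (D k).
    by have [->//|[z _ ->]] := DE k; exact: measurable_dyadic_square.
  have tD : trivIset setT D.
    apply/trivIsetP => i j _ _ ij; rewrite -subset0 => x [].
    rewrite /D; case ei: (@pickle_inv (int * int)%type i) => [z|//] [_ xz].
    case ej: (@pickle_inv (int * int)%type j) => [z'|//] [_ xz'].
    have := @pickle_invK (int * int)%type i; rewrite ei /= -xz xz' => iE.
    have := @pickle_invK (int * int)%type j; rewrite ej /= => jE.
    by move: ij; rewrite -iE -jE eqxx.
  have AE : A = \bigcup_k D k.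
    apply/seteqP; split=> [x Ax|x [k _]]; last first.
      by rewrite /D; case: (@pickle_inv (int * int)%type k) => // z [].
    exists (pickle (dyadic_index n x)); first exact: I.
    by rewrite /D pickleK_inv; split.
  split; first by rewrite AE; exact: bigcupT_measurable.
  rewrite AE !measure_bigcup// -nneseriesZl//; apply: lee_nneseries => // k _.
  by have [->|[z _ ->]] := DE k; rewrite ?measure0 ?mule0 ?numu.
- split=> F mono GF.
    have mU : measurable (\bigcup_i F i).
      by apply: bigcupT_measurable => i; have [] := GF i.
    split=> //.
    have mF i : measurable (F i) by have [] := GF i.
    have cn := nondecreasing_cvg_mu (mu := nu) mF mU mono.
    have cm := nondecreasing_cvg_mu (mu := mu) mF mU mono.
    rewrite -(cvg_lim _ cn)// -(cvg_lim _ (cvgeZl _ cm))//.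
    apply: lee_lim; [exact: cvgP cn|by apply: cvgP (cvgeZl _ cm)|].
    by near=> i; have [] := GF i.
  have mU : measurable (\bigcap_i F i).
    by apply: bigcapT_measurable => i; have [] := GF i.
  split=> //.
  have mF i : measurable (F i) by have [] := GF i.
  have cn := nonincreasing_cvg_mu (mu := nu) (fin_lty nu _ nufin (mF 0%N)) mF mU mono.
  have cm := nonincreasing_cvg_mu (mu := mu) (fin_lty mu _ mufin (mF 0%N)) mF mU mono.
  rewrite -(cvg_lim _ cn)// -(cvg_lim _ (cvgeZl _ cm))//.
  apply: lee_lim; [exact: cvgP cn|by apply: cvgP (cvgeZl _ cm)|].
  by near=> i; have [] := GF i.
Unshelve. all: by end_near. Qed.

End Dyadic.

(** * The area inequality *)

Section Area.
Context {R : realType}.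
Implicit Types A B : set (plane R).

(** Cramer's rule bounds [x.1 - p.1] by a multiple of [|b| + |d|]; on a vertical line, the form with
    the larger of the coefficients [b] and [d] bounds the oscillation of [x.2]. The quotient of
    [|b| + |d|] by that coefficient is at most 2. The true area is [4 * s ^+ 2] over the
    determinant, so a factor 4 is lost. *)
Lemma leb2_parallelogram_le A (p : R * R) (a b c d s : R) : measurable A -> 0 <= s ->
    a * d - b * c != 0 ->
    (forall x, A x -> `|a * (x.1 - p.1) + b * (x.2 - p.2)| <= s) ->
    (forall x, A x -> `|c * (x.1 - p.1) + d * (x.2 - p.2)| <= s) ->
  (leb2 A <= (16 * s ^+ 2 / `|a * d - b * c|)%:E)%E.
Proof.
move=> mA s0 D0 h1 h2.
set D := a * d - b * c in D0 *.
have DN0 : 0 < `|D| by rewrite normr_gt0.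
have hx x : A x -> `|x.1 - p.1| <= (`|b| + `|d|) * s / `|D|.
  move=> Ax; rewrite ler_pdivlMr// -normrM.
  have -> : (x.1 - p.1) * D = d * (a * (x.1 - p.1) + b * (x.2 - p.2))
      - b * (c * (x.1 - p.1) + d * (x.2 - p.2)) by rewrite /D; ring.
  rewrite (le_trans (ler_normB _ _))// !normrM mulrDl addrC.
  by apply: lerD; rewrite ler_wpM2l ?h1 ?h2.
have h0 : 0 <= (`|b| + `|d|) * s / `|D|.
  by rewrite !mulr_ge0 ?invr_ge0 ?addr_ge0.
have main M : 0 < `|M| -> `|b| + `|d| <= 2 * `|M| ->
   (forall x y, A x -> A y -> x.1 = y.1 -> `|M * (x.2 - y.2)| <= 2 * s) ->
   (leb2 A <= (16 * s ^+ 2 / `|D|)%:E)%E.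
  move=> M0 bdM hM.
  apply: (le_trans (@leb2_le_sections _ A p.1 _ (2 * s / `|M|) mA h0 _ hx _)).
  - by rewrite !mulr_ge0 ?invr_ge0.
  - move=> x y Ax Ay xy; rewrite ler_pdivlMr// mulrC -normrM.
    exact: hM.
  - rewrite lee_fin ler_pdivlMr//.
    have -> : 4 * ((`|b| + `|d|) * s / `|D|) * (2 * s / `|M|) * `|D|
       = 8 * s ^+ 2 * ((`|b| + `|d|) / `|M|).
      by field; rewrite !gt_eqF.
    have : (`|b| + `|d|) / `|M| <= 2 by rewrite ler_pdivrMr.
    have : 0 <= s ^+ 2 by rewrite sqr_ge0.
    by nra.
have sec (e f : R) : (forall x, A x -> `|e * (x.1 - p.1) + f * (x.2 - p.2)| <= s) ->
    forall x y, A x -> A y -> x.1 = y.1 -> `|f * (x.2 - y.2)| <= 2 * s.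
  move=> h x y Ax Ay xy.
  have -> : f * (x.2 - y.2) = (e * (x.1 - p.1) + f * (x.2 - p.2))
      - (e * (y.1 - p.1) + f * (y.2 - p.2)) by rewrite xy; ring.
  by rewrite (le_trans (ler_normB _ _))// mulr_natl mulr2n lerD ?h.
have nbd : 0 < `|b| + `|d|.
  rewrite lt_neqAle addr_ge0// andbT eq_sym paddr_eq0// !normr_eq0.
  apply/negP => /andP[/eqP b0 /eqP d0]; move/negP: D0; apply.
  by rewrite /D b0 d0 mulr0 mul0r subrr.
have [bd|bd] := leP `|b| `|d|.
  by apply: (main d); [lra|lra|exact: sec h2].
by apply: (main b); [lra|lra|exact: sec h1].
Qed.

(** Integer corners and half-open sides make [box] a union of dyadic squares of every generation, so
    a square that meets the image of a piece lies wholly in [box]. The corners are at 2 because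
    coordinates of the image may equal 1. *)
Let box : set (plane R) := `[-2, 2[%classic `*` `[-2, 2[%classic.

Let measurable_box : measurable box.
Proof. by apply: measurableX; exact: measurable_itv. Qed.

Let leb2_box : leb2 box = 16%:E.
Proof.
rewrite /box leb2X; [|exact: measurable_itv..].
have len : lebesgue_measure (`[-2, 2[%classic : set R) = 4%:E.
  rewrite lebesgue_measure_itv/= lte_fin -EFinB ifT; last by lra.
  by congr EFin; lra.
by rewrite len -EFinM; congr EFin; lra.
Qed.

Let box_dyadic n (x y : R * R) : dyadic_index n x = dyadic_index n y ->
  box x -> box y.
Proof.
move=> /(dyadic_index_le (leq0n n)) []; rewrite expr0 !mul1r => h1 h2.
have E (t : R) : (t \in `[-2, 2[) = (-2 <= Num.floor t) && (Num.floor t < 2).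
  by rewrite in_itv/= floor_ge_int floor_lt_int.
by rewrite /box/= !E h1 h2.
Qed.

(** Two finite measures are compared on dyadic squares: the push-forward by [F] of Lebesgue measure
    on [A], and Lebesgue measure on [box]. On the preimage in [A] of a square of side [s] both
    linear forms are at most [2 * s], so the parallelogram bound gives [16 * (2 * s) ^+ 2], whence
    the 64. The comparison is then evaluated at [B]. *)
Lemma leb2_le_expanding A B (F : plane R -> R * R) (a b c d : R) :
    measurable A -> (leb2 A < +oo)%E -> measurable_fun setT (F : plane R -> plane R) ->
    measurable B -> (forall x, B x -> `|x.1| <= 1 /\ `|x.2| <= 1) ->
    (forall x, A x -> B (F x)) ->
    (forall (x y : R * R) (s : R), A x -> A y ->
      `|(F x).1 - (F y).1| <= s -> `|(F x).2 - (F y).2| <= s ->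
      `|a * (x.1 - y.1) + b * (x.2 - y.2)| <= 2 * s /\
      `|c * (x.1 - y.1) + d * (x.2 - y.2)| <= 2 * s) ->
    a * d - b * c != 0 ->
  (`|a * d - b * c|%:E * leb2 A <= 64%:E * leb2 B)%E.
Proof.
move=> mA Afin mF mB B1 AB expand D0.
set D := a * d - b * c in D0 *.
have DN0 : 0 < `|D| by rewrite normr_gt0.
pose nu := pushforward (mrestr leb2 mA) (F : plane R -> plane R).
pose nuf := nu : {measure set (plane R) -> \bar R}; pose nu' := nuf mF.
pose mu : {measure set (plane R) -> \bar R} := mrestr leb2 measurable_box.
have nuE C : nu' C = leb2 (F @^-1` C `&` A) by [].
have muE C : mu C = leb2 (C `&` box) by [].
have mFC C : measurable C -> measurable (F @^-1` C `&` A).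
  by move=> mC; apply: measurableI => //; rewrite -[X in measurable X]setTI; exact: (mF).
have Bbox x : B x -> box x.
  move=> /B1[]; rewrite !ler_norml => /andP[? ?] /andP[? ?].
  by split; rewrite /= in_itv/=; apply/andP; split; lra.
have cmp : forall C, measurable C -> (nu' C <= (64 / `|D|)%:E * mu C)%E.
  apply: measure_le_dyadic.
  - by rewrite nuE preimage_setT setTI.
  - by rewrite muE setTI leb2_box ltry.
  - by rewrite divr_ge0.
  move=> n z; have mS := @measurable_dyadic_square R n z.
  have [[y [Sy Ay]]|nA] := pselect (exists y, (F @^-1` dyadic_square n z `&` A) y);
      last first.
    rewrite nuE (_ : _ `&` _ = set0) ?measure0 ?mule_ge0 ?lee_fin ?divr_ge0//.
    by rewrite -subset0 => y hy; apply: nA; exists y.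
  rewrite muE (_ : _ `&` box = dyadic_square n z); last first.
    apply/seteqP; split=> [x []//|x Sx]; split=> //.
    by apply: (@box_dyadic n (F y)); [rewrite Sy Sx|exact/Bbox/AB].
  rewrite leb2_dyadic_square nuE -EFinM.
  set s := (2 ^+ n)^-1.
  have s0 : 0 <= s by rewrite invr_ge0 exprn_ge0.
  have side x : (F @^-1` dyadic_square n z) x ->
      `|(F x).1 - (F y).1| <= s /\ `|(F x).2 - (F y).2| <= s.
    move=> Sx.
    by have [? ?] : dyadic_index n (F x) = dyadic_index n (F y); [rewrite Sx Sy|split; exact: floor_dist].
  apply: (le_trans (@leb2_parallelogram_le _ y a b c d (2 * s) _ _ D0 _ _)).
  - exact: mFC.
  - by rewrite mulr_ge0.
  - by move=> x [/side[h1 h2] Ax]; have [] := expand _ _ _ Ax Ay h1 h2.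
  - by move=> x [/side[h1 h2] Ax]; have [] := expand _ _ _ Ax Ay h1 h2.
  - rewrite lee_fin -/D le_eqVlt; apply/orP; left; apply/eqP; field.
    by rewrite gt_eqF.
have := cmp _ mB; rewrite nuE muE.
rewrite (_ : _ `&` A = A); last first.
  by apply/seteqP; split=> [x []//|x Ax]; split=> //; exact: AB.
rewrite (_ : _ `&` box = B); last first.
  by apply/seteqP; split=> [x []//|x Bx]; split=> //; exact: Bbox.
move=> h.
apply: (@le_trans _ _ (`|D|%:E * ((64 / `|D|)%:E * leb2 B))%E).
  by apply: lee_wpmul2l => //; rewrite lee_fin.
by rewrite muleA -EFinM mulrCA divff ?gt_eqF// mulr1.
Qed.

End Area.

(** * Summation over disjoint pieces *)

Section AreaInequality.
Context {R : realType}.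

Lemma measurable_plane_eq (f g : plane R -> R) :
  measurable_fun setT f -> measurable_fun setT g ->
  measurable [set x | f x = g x].
Proof.
move=> mf mg.
have := measurable_funB mf mg measurableT (measurable_set1 (0 : R)).
rewrite setTI (_ : _ @^-1` _ = [set x | f x = g x])//.
apply/seteqP; split=> x /=; rewrite /GRing.add_fun/=; last by move->; rewrite subrr.
by move/eqP; rewrite subr_eq0 => /eqP.
Qed.

(* The images of disjoint pieces are disjoint, because [F] is injective on [E],
   and measurable, because its left inverse [G] is. *)
Lemma area_inequality (E : set (plane R)) (J : plane R -> R)
    (F G : plane R -> plane R) (P : nat -> set (plane R)) :
    measurable E -> (leb2 E < +oo)%E ->
    measurable_fun setT F -> measurable_fun setT G ->
    measurable_fun E J -> (forall x, E x -> 0 <= J x) ->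
    (forall x, E x -> G (F x) = x) ->
    (forall x, E x -> `|(F x).1| <= 1 /\ `|(F x).2| <= 1) ->
    (forall n, measurable (P n)) -> (forall n, P n `<=` E) ->
    (forall x, E x -> 0 < J x -> exists n, P n x) ->
    (forall n, exists a b c d : R, [/\ a * d - b * c != 0,
      forall x, P n x -> J x <= 2 * `|a * d - b * c| &
      forall (x y : R * R) (s : R), P n x -> P n y ->
      `|(F x).1 - (F y).1| <= s -> `|(F x).2 - (F y).2| <= s ->
      `|a * (x.1 - y.1) + b * (x.2 - y.2)| <= 2 * s /\
      `|c * (x.1 - y.1) + d * (x.2 - y.2)| <= 2 * s]) ->
  (\int[leb2]_(x in E) (J x)%:E < +oo)%E.
Proof.
move=> mE Efin mF mG mJ J0 GF F1 mP PE EP LP.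
pose P' := seqDU P.
have mP' n : measurable (P' n).
  by apply: measurableD => //; apply: bigsetU_measurable => i _.
have P'P n : P' n `<=` P n by apply: subDsetl.
pose S : set (plane R) := `[-1, 1]%classic `*` `[-1, 1]%classic.
have mS : measurable S by apply: measurableX; exact: measurable_itv.
have Sfin : (leb2 S < +oo)%E.
  rewrite /S leb2X; [|exact: measurable_itv..].
  rewrite lebesgue_measure_itv/= lte_fin -EFinB ifT; last by lra.
  by rewrite -EFinM ltry.
have S1 x : S x -> `|x.1| <= 1 /\ `|x.2| <= 1.
  by move=> [/=]; rewrite !in_itv/= !ler_norml.
have mFG : measurable [set q | F (G q) = q].
  rewrite (_ : [set q | _] = [set q | (F (G q)).1 = q.1] `&` [set q | (F (G q)).2 = q.2]).
    have mFGc := measurableT_comp mF mG.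
    apply: measurableI; apply: measurable_plane_eq.
    - exact: (measurableT_comp measurable_fst2 mFGc).
    - exact: measurable_fst2.
    - exact: (measurableT_comp measurable_snd2 mFGc).
    - exact: measurable_snd2.
  apply/seteqP; split=> [q /= ->//|q /= [h1 h2]].
  by rewrite [LHS]surjective_pairing h1 h2 -surjective_pairing.
pose V n := S `&` (G @^-1` P' n `&` [set q | F (G q) = q]).
have mV n : measurable (V n).
  apply: measurableI => //; apply: measurableI => //.
  by rewrite -[X in measurable X]setTI; exact: (mG).
have tV : trivIset setT V.
  apply/trivIsetP => i j _ _ ij; rewrite -subset0 => q [[_ [hi _]] [_ [hj _]]].
  have /trivIsetP/(_ i j I I ij) := @trivIset_seqDU _ P.
  by rewrite -subset0 => /(_ (G q)); apply.
(* 128 is the 2 that compares [J] with the determinant, times the 64 of [leb2_le_expanding]. *)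
have step n : (\int[leb2]_(x in P' n) (J x)%:E <= 128%:E * leb2 (V n))%E.
  have [a [b [c [d [D0 JD ex]]]]] := LP n.
  set D := `|a * d - b * c| in JD.
  have P'E : P' n `<=` E by apply: subset_trans (PE n); exact: P'P.
  apply: (@le_trans _ _ (\int[leb2]_(x in P' n) (2 * D)%:E)%E).
    apply: ge0_le_integral => //.
    - by move=> x /P'E /J0 ?; rewrite lee_fin.
    - by apply/measurable_EFinP; exact: measurable_funS mJ.
    - by move=> x /P'P /JD; rewrite lee_fin.
  rewrite integral_cst// EFinM -muleA.
  apply: (@le_trans _ _ (2%:E * (64%:E * leb2 (V n)))%E).
    apply: lee_wpmul2l; first by rewrite lee_fin.
    apply: (@leb2_le_expanding _ (P' n) (V n) F a b c d) => //.
    - by apply: le_lt_trans Efin; exact: le_leb2.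
    - by move=> x [/S1].
    - move=> x Px; have Ex := P'E _ Px; split; last by rewrite /= GF.
      have [h1 h2] := F1 _ Ex.
      by split; rewrite /= in_itv/= -ler_norml.
    - by move=> x y s /P'P Px /P'P Py; exact: ex.
  by rewrite muleA -EFinM; apply: lee_wpmul2r => //; rewrite lee_fin; lra.
have mUP : measurable (\bigcup_n P' n) by exact: bigcupT_measurable.
have UE : \bigcup_n P' n `<=` E.
  by apply: bigcup_sub => n _; apply: subset_trans (PE n); exact: P'P.
have -> : (\int[leb2]_(x in E) (J x)%:E = \int[leb2]_(x in \bigcup_n P' n) (J x)%:E)%E.
  rewrite -{1}(setDUK UE) ge0_integral_setU//=; last 4 first.
  - exact: measurableD.
  - by rewrite setDUK//; apply/measurable_EFinP.
  - by move=> x [/UE|[+ _]] => /J0 ?; rewrite lee_fin.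
  - by rewrite disj_set2E setDIK.
  (* The pieces contain every point of [E] where [J] is positive, so [J] vanishes on the rest. *)
  rewrite [X in (_ + X)%E](_ : _ = 0)%E ?adde0//.
  apply: integral0_eq => x [Ex nx]; congr EFin; apply/eqP; rewrite eq_le J0// andbT leNgt.
  apply/negP => /(EP _ Ex)[n Pn]; apply: nx.
  by rewrite /P' -seqDU_bigcup_eq; exists n.
rewrite ge0_integral_bigcup//; last 3 first.
- by apply/measurable_EFinP; exact: measurable_funS mJ.
- by move=> x /UE /J0 ?; rewrite lee_fin.
- exact: trivIset_seqDU.
apply: (@le_lt_trans _ _ (128%:E * leb2 S)%E); last by rewrite lte_mul_pinfty.
apply: (@le_trans _ _ (\sum_(n <oo) (128%:E * leb2 (V n)))%E).
  apply: lee_nneseries => [n _ _|n _]; last exact: step.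
  by apply: integral_ge0 => x /P'P /PE /J0 ?; rewrite lee_fin.
rewrite nneseriesZl//; apply: lee_wpmul2l; first by rewrite lee_fin.
rewrite [leLHS](_ : _ = leb2 (\bigcup_n V n)); last first.
  by rewrite measure_bigcup//; apply: eq_eseriesl => n; rewrite in_setT.
by apply: le_leb2 => //; [exact: bigcupT_measurable|apply: bigcup_sub => n _ q []].
Qed.

End AreaInequality.

(** * Densities *)

Section PlaneGeometry.
Context {R : realType}.
Implicit Types (x y : R * R) (f : R * R -> R).

Lemma measurable_le_set d (T : measurableType d) (f g : T -> R) :
  measurable_fun setT f -> measurable_fun setT g -> measurable [set x | f x <= g x].
Proof.
move=> mf mg.
have := measurable_funB mg mf measurableT (measurable_itv `[0, +oo[).
rewrite setTI (_ : _ @^-1` _ = [set x | f x <= g x])//.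
by apply/seteqP; split=> x /=; rewrite in_itv/= andbT subr_ge0.
Qed.

Lemma measurable_lt_set d (T : measurableType d) (f g : T -> R) :
  measurable_fun setT f -> measurable_fun setT g -> measurable [set x | f x < g x].
Proof.
move=> mf mg; rewrite (_ : [set x | _] = ~` [set x | g x <= f x]).
  by apply: measurableC; exact: measurable_le_set.
by apply/seteqP; split=> x /=; rewrite ltNge => /negP.
Qed.

Definition half (n : nat) : R := 2^-1 ^+ n.

Lemma half_gt0 n : 0 < half n. Proof. by rewrite exprn_gt0// invr_gt0. Qed.

Lemma halfS n : half n.+1 = half n / 2. Proof. by rewrite /half exprS mulrC. Qed.

Lemma half_le m n : (m <= n)%N -> half n <= half m.
Proof. by move=> mn; rewrite /half; apply: ler_wiXn2l => //; lra. Qed.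

Lemma half_lt (e : R) : 0 < e -> exists n, half n < e.
Proof.
move=> e0; have [n _ /(_ n (leqnn n)) /= nlt] := near_infty_natSinv_lt (PosNum e0).
exists n; apply: le_lt_trans nlt.
rewrite /half exprVn lef_pV2 ?posrE ?exprn_gt0//.
by rewrite -natrX ler_nat ltn_expl.
Qed.

(** The least [n >= m] with [half n < 4 * d] works: if it is [m], the hypothesis on [d] applies;
    otherwise minimality gives [4 * d <= half n.-1], which is [d <= half n.+1]. *)
Lemma half_between (m : nat) (d : R) : 0 < d -> d <= half m.+1 ->
  exists n, [/\ (m <= n)%N, d <= half n.+1 & half n < 4 * d].
Proof.
move=> d0 dm.
have ex : exists n, (m <= n)%N && (half n < 4 * d).
  have [n hn] := half_lt d0; exists (maxn m n); rewrite leq_maxl/=.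
  by have := half_le (leq_maxr m n); lra.
exists (ex_minn ex); case: ex_minnP => n /andP[mn hn] minn; split => //.
have [->//|nm] := eqVneq n m.
case: n mn hn minn nm => [|n] mn hn minn nm; first by move: mn nm; rewrite leqn0 eq_sym => ->.
have mn' : (m <= n)%N by rewrite -ltnS ltn_neqAle eq_sym nm.
have : ~~ (half n < 4 * d).
  by apply/negP => h; have := minn n; rewrite mn' h ltnn => /(_ isT).
by rewrite -leNgt !halfS; lra.
Qed.

Definition lin (L : R * R) (x y : R * R) : R := L.1 * (y.1 - x.1) + L.2 * (y.2 - x.2).

(** The l1 distance is dual to bounds on the coefficients of a linear form, as in [lin_le], and is
    comparable with [dist2] up to a factor 2. *)
Definition dist1 (x y : R * R) : R := `|y.1 - x.1| + `|y.2 - x.2|.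

Lemma dist1_ge0 x y : 0 <= dist1 x y. Proof. exact: addr_ge0. Qed.

Lemma dist1_eq0 x y : dist1 x y <= 0 -> y = x.
Proof.
move=> h; have := normr_ge0 (y.1 - x.1); have := normr_ge0 (y.2 - x.2).
rewrite /dist1 in h => h2 h1.
have /normr0_eq0/subr0_eq e1 : `|y.1 - x.1| = 0 by lra.
have /normr0_eq0/subr0_eq e2 : `|y.2 - x.2| = 0 by lra.
by rewrite [y]surjective_pairing e1 e2 -surjective_pairing.
Qed.

Lemma lin_le (L : R * R) x y (e : R) : `|L.1| <= e -> `|L.2| <= e ->
  `|lin L x y| <= e * dist1 x y.
Proof.
move=> h1 h2; rewrite (le_trans (ler_normD _ _))// !normrM mulrDr.
by rewrite lerD// ler_wpM2r.
Qed.

Lemma dist2_sym x y : dist2 x y = dist2 y x.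
Proof. by rewrite /dist2 -sqrrN opprB; congr (Num.sqrt (_ + _)); rewrite -sqrrN opprB. Qed.

Lemma dist2_le_dist1 x y : dist2 y x <= dist1 x y.
Proof.
rewrite /dist2 -[leRHS]ger0_norm ?dist1_ge0// -sqrtr_sqr ler_wsqrtr//.
rewrite /dist1; have := normr_ge0 (y.1 - x.1); have := normr_ge0 (y.2 - x.2).
by rewrite -(real_normK (num_real (y.1 - x.1))) -(real_normK (num_real (y.2 - x.2))); nra.
Qed.

Lemma norm_le_hypot (a b : R) : `|a| <= Num.sqrt (a ^+ 2 + b ^+ 2) /\
  `|b| <= Num.sqrt (a ^+ 2 + b ^+ 2).
Proof.
by split; rewrite -sqrtr_sqr ler_wsqrtr// ?lerDl ?lerDr sqr_ge0.
Qed.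

Lemma dist1_le_dist2 x y : dist1 x y <= 2 * dist2 y x.
Proof.
have [] := norm_le_hypot (y.1 - x.1) (y.2 - x.2).
by rewrite /dist1 /dist2; lra.
Qed.

Lemma dist1_ball x (r : R) y : ball x r y -> dist1 x y < 2 * r.
Proof. by move=> []; rewrite /ball/= /dist1 distrC [X in _ -> X < _ -> _]distrC; lra. Qed.

Lemma disc_sub_ball x (r : R) : disc x r `<=` ball x r.
Proof.
move=> y; rewrite /disc/= /dist2 => h.
by split; rewrite /ball/=; apply: le_lt_trans h; have [] := norm_le_hypot (x.1 - y.1) (x.2 - y.2).
Qed.

Lemma ball_sub_disc x (r : R) : ball x (r / 2) `<=` disc x r.
Proof.
move=> y /dist1_ball h; rewrite /disc/= dist2_sym.
by apply: le_lt_trans (dist2_le_dist1 _ _) _; lra.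
Qed.

Lemma measurable_sqrt : measurable_fun setT (@Num.sqrt R).
Proof. by apply: continuous_measurable_fun; exact: sqrt_continuous. Qed.

Lemma measurable_dist2 x : measurable_fun setT (fun y : plane R => dist2 y x).
Proof.
suff h : measurable_fun setT (fun y : plane R => (y.1 - x.1) ^+ 2 + (y.2 - x.2) ^+ 2).
  exact: (measurableT_comp measurable_sqrt h).
by apply: measurable_funD; apply: measurable_funX; apply: measurable_funB => //;
  first [exact: measurable_fst2|exact: measurable_snd2].
Qed.

Lemma measurable_disc x (r : R) : measurable (disc x r : set (plane R)).
Proof.
rewrite (_ : disc x r = [set y | dist2 y x < cst r y]).
  exact: measurable_lt_set (measurable_dist2 x) (measurable_cst _).
by apply/seteqP; split => y; rewrite /disc /= dist2_sym.
Qed.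

Lemma measurable_Q : measurable (Q : set (plane R)).
Proof. by apply: measurableX; exact: measurable_itv. Qed.

Definition open_square : set (plane R) := [set x | (0 < x.1 < 1) /\ (0 < x.2 < 1)].

Lemma open_square_subQ : open_square `<=` (Q : set (plane R)).
Proof.
move=> x [/andP[? ?] /andP[? ?]]; split; rewrite /= in_itv/=;
  by apply/andP; split; apply: ltW.
Qed.

End PlaneGeometry.

Section Density.
Context {R : realType} (S : set (plane R)).
Hypothesis mS : measurable S.
Hypothesis nullS : leb2 ((Q : set (plane R)) `\` S) = 0%E.
Implicit Types (x y : R * R).

(** A union bound: the ball has measure [4 * r ^+ 2], almost all of it lies in [S], and the two
    exceptional sets together are too small to cover it. *)
Lemma exists_good_point x (r r1 r2 : R) (B1 B2 : set (plane R)) : 0 <= r ->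
    ball x r `<=` (Q : set (R * R)) -> measurable B1 -> measurable B2 ->
    (leb2 B1 <= r1%:E)%E -> (leb2 B2 <= r2%:E)%E -> r1 + r2 < 4 * r ^+ 2 ->
  exists y, [/\ ball x r y, S y, ~ B1 y & ~ B2 y].
Proof.
move=> r0 bQ mB1 mB2 h1 h2 r12; apply/not_existsP => noy.
have mQS : measurable ((Q : set (plane R)) `\` S) by apply: measurableD => //; exact: measurable_Q.
have : (leb2 (ball x r) <= leb2 (((Q : set (plane R)) `\` S) `|` (B1 `|` B2)))%E.
  apply: le_leb2; [exact: measurable_plane_ball|by apply: measurableU => //; exact: measurableU|].
  move=> y xy; have [Sy|nSy] := pselect (S y); last by left; split => //; exact: bQ.
  right; apply: contrapT => /not_orP[n1 n2]; exact: (noy y).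
apply/negP; rewrite -ltNge leb2_ball//.
apply: (@le_lt_trans _ _ (r1 + r2)%:E); last by rewrite lte_fin.
apply: (le_trans (measureU2 _ _ _)) => //; first exact: measurableU.
rewrite /= nullS add0e; apply: (le_trans (measureU2 _ _ _)) => //.
by rewrite EFinD leeD.
Qed.

(* A set is compared with the dyadic balls only through its trace on [S],
   which is measurable even when the set itself is not. *)
Lemma density0P (E : set (R * R)) x : E `<=` Q ->
    measurable ((E : set (plane R)) `&` S) ->
  density0 E x <-> forall k : R, 0 < k -> exists m, forall n, (m <= n)%N ->
    (leb2 (((E : set (plane R)) `&` S) `&` ball x (half n)) <= (k * half n ^+ 2)%:E)%E.
Proof.
move=> EQ mE.
have mD r : measurable (disc x r : set (plane R)) by exact: measurable_disc.
have fD r A : measurable A -> 0 < r -> leb2 (A `&` disc x r) \is a fin_num.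
  move=> mA r0; rewrite ge0_fin_numE//.
  apply: (@le_lt_trans _ _ (leb2 (ball x r))); last by rewrite leb2_ball ?ltry// ltW.
  apply: le_leb2; [exact: measurableI|exact: measurable_plane_ball|].
  by apply: subset_trans (@disc_sub_ball _ _ _); exact: subIsetr.
have Dge r : 0 < r -> r ^+ 2 <= fine (leb2 (disc x r)).
  move=> r0; rewrite -lee_fin fineK; last by rewrite -[disc _ _]setTI fD.
  have -> : (r ^+ 2)%:E = leb2 (ball x (r / 2)).
    by rewrite leb2_ball; [congr EFin; field|lra].
  by apply: le_leb2; [exact: measurable_plane_ball|exact: mD|exact: ball_sub_disc].
have Dle r : 0 < r -> fine (leb2 (disc x r)) <= 4 * r ^+ 2.
  move=> r0; rewrite -lee_fin fineK; last by rewrite -[disc _ _]setTI fD.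
  rewrite -(leb2_ball x (ltW r0)).
  by apply: le_leb2; [exact: mD|exact: measurable_plane_ball|exact: disc_sub_ball].
split.
  move=> [A [mA EA cvA]] k k0.
  (* The disc of radius [2 * half n] contains the ball of radius [half n] and has measure at most
     [16 * half n ^+ 2]. *)
  have k160 : 0 < k / 16 by rewrite divr_gt0.
  have [e /= e0 he] : \forall r \near 0^'+,
      fine (leb2 (A `&` disc x r)) / fine (leb2 (disc x r)) < k / 16.
    have := cvA => /cvgrPdist_lt /(_ _ k160).
    by apply: filterS => r /=; rewrite distrC subr0; apply: le_lt_trans; exact: ler_norm.
  have [m hm] := half_lt (divr_gt0 e0 (ltr0n R 2)).
  exists m => n mn.
  have hn0 := @half_gt0 R n.
  have hn2 : 0 < 2 * half n :> R by rewrite mulr_gt0.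
  have := half_le (R := R) mn => hmn.
  have /he : ball 0 e (2 * half n : R).
    by rewrite /ball/= sub0r normrN gtr0_norm//; lra.
  move=> /(_ hn2); rewrite ltr_pdivrMr; last first.
    by apply: lt_le_trans (Dge _ hn2); rewrite exprn_gt0.
  move=> lt1; have := Dle _ hn2 => le2.
  apply: (@le_trans _ _ (leb2 (A `&` disc x (2 * half n)))).
    apply: le_leb2.
    - by apply: measurableI => //; exact: measurable_plane_ball.
    - exact: measurableI.
    - move=> y [[Ey _] xy]; split; first exact: EA.
      by apply: ball_sub_disc; rewrite mulrAC divff// mul1r.
  rewrite -(@fineK _ (leb2 (A `&` _))); last exact: fD.
  by rewrite lee_fin; nra.
move=> h.
exists (((E : set (plane R)) `&` S) `|` ((Q : set (plane R)) `\` S)).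
have mQS : measurable ((Q : set (plane R)) `\` S) by apply: measurableD => //; exact: measurable_Q.
split.
- exact: measurableU.
- by move=> y Ey; have [Sy|nSy] := pselect (S y); [left|right; split=> //; exact: EQ].
apply/cvgrPdist_lt => eps eps0.
(* With [half n < 4 * r] the square of [half n] is at most [16 * r ^+ 2], while the disc has measure
   at least [r ^+ 2]; so 32 leaves a ratio of at most [eps / 2]. *)
have [m hm] := h _ (divr_gt0 eps0 (ltr0n R 32)).
near=> r.
have r0 : 0 < r by near: r; exact: nbhs_right_gt.
have rm : r <= half m.+1 by near: r; apply: nbhs_right_le; exact: half_gt0.
have [n [mn rn nr]] := half_between r0 rm.
have Dr := Dge _ r0.
have D0 : 0 < fine (leb2 (disc x r)) by apply: lt_le_trans Dr; rewrite exprn_gt0.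
rewrite sub0r normrN ger0_norm; last by rewrite divr_ge0// fine_ge0.
rewrite ltr_pdivrMr//.
apply: (@le_lt_trans _ _ (eps / 32 * half n ^+ 2)); last first.
  have h1 : half n ^+ 2 <= 16 * r ^+ 2 by have := @half_gt0 R n; nra.
  have h2 : 0 < r ^+ 2 by rewrite exprn_gt0.
  apply: (@lt_le_trans _ _ (eps * r ^+ 2)); last by rewrite ler_pM2l.
  by rewrite -mulrA ltr_pM2l//; lra.
rewrite -lee_fin fineK; last by apply: fD => //; exact: measurableU.
apply: le_trans (hm _ mn).
rewrite setIUl; apply: (le_trans (measureU2 _ _ _)).
- exact: measurableI.
- exact: measurableI.
rewrite -[leRHS]adde0; apply: leeD.
  apply: le_leb2.
  - exact: measurableI.
  - by apply: measurableI => //; exact: measurable_plane_ball.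
  - move=> y [Ey /disc_sub_ball xy]; split => //; apply: le_ball xy.
    by apply: (le_trans rn); rewrite halfS; have := @half_gt0 R n; lra.
rewrite -nullS; apply: le_leb2; [exact: measurableI|by []|exact: subIsetl].
Unshelve. all: by end_near. Qed.

End Density.

(** * Nearly affine behaviour and the approximate gradient *)

(** The points of [S] where the affine function of slope [L] through [(x, f x)] misses [f] by a
    relative error of at least [c]. The clause [0 < dist1 x y] removes [x] itself, where the
    difference quotient of [ap_differential] has the value [0]. *)
Definition bad {R : realType} (S : set (R * R)) (f : R * R -> R) (L : R * R) (c : R)
    (x : R * R) : set (plane R) :=
  [set y | [/\ S y, 0 < dist1 x y & c * dist1 x y <= `|f y - f x - lin L x y|]].

(* The factor [16] leaves room, in a quarter of each ball, for a point which is
   bad for neither of two affine approximations. *)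
Definition near_affine {R : realType} (S : set (R * R)) (f : R * R -> R) (L : R * R)
    (c : R) (m : nat) : set (plane R) :=
  [set x | S x /\ forall n, (m <= n)%N ->
    (leb2 (bad S f L c x `&` ball x (half n)) <= (c / 16 * half n ^+ 2)%:E)%E].

Section NearAffine.
Context {R : realType} (S : set (plane R)) (f : R * R -> R).
Hypothesis mS : measurable S.
Hypothesis nullS : leb2 ((Q : set (plane R)) `\` S) = 0%E.
Hypothesis mf : measurable_fun S (f : plane R -> R).
Implicit Types (x y L : R * R).

(** Its sections are the sets [bad]. Measurability in the product makes the measure of these
    sections a measurable function of [x], hence [near_affine] measurable. *)
Let pairs L c : set (plane R * plane R) :=
  [set z | [/\ S z.1, S z.2, 0 < dist1 z.1 z.2 &
    c * dist1 z.1 z.2 <= `|f z.2 - f z.1 - lin L z.1 z.2|]].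

Let c11 : measurable_fun setT (fun z : plane R * plane R => z.1.1 : R).
Proof. exact: (measurableT_comp measurable_fst2 measurable_fst). Qed.
Let c12 : measurable_fun setT (fun z : plane R * plane R => z.1.2 : R).
Proof. exact: (measurableT_comp measurable_snd2 measurable_fst). Qed.
Let c21 : measurable_fun setT (fun z : plane R * plane R => z.2.1 : R).
Proof. exact: (measurableT_comp measurable_fst2 measurable_snd). Qed.
Let c22 : measurable_fun setT (fun z : plane R * plane R => z.2.2 : R).
Proof. exact: (measurableT_comp measurable_snd2 measurable_snd). Qed.

Let measurable_pairs L c : measurable (pairs L c).
Proof.
pose g : plane R -> R := f \_ S.
have mg : measurable_fun setT g by exact/(measurable_restrictT f mS).
have mg1 : measurable_fun setT (fun z : plane R * plane R => g z.1).
  exact: (measurableT_comp mg measurable_fst).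
have mg2 : measurable_fun setT (fun z : plane R * plane R => g z.2).
  exact: (measurableT_comp mg measurable_snd).
have md1 : measurable_fun setT (fun z : plane R * plane R => z.2.1 - z.1.1 : R).
  exact: measurable_funB.
have md2 : measurable_fun setT (fun z : plane R * plane R => z.2.2 - z.1.2 : R).
  exact: measurable_funB.
have md : measurable_fun setT (fun z : plane R * plane R => dist1 z.1 z.2).
  by apply: measurable_funD; exact: measurableT_comp.
have ml : measurable_fun setT (fun z : plane R * plane R => lin L z.1 z.2).
  by apply: measurable_funD; exact: measurable_funM.
rewrite (_ : pairs L c = (S `*` S) `&` ([set z | 0 < dist1 z.1 z.2] `&`
    [set z | c * dist1 z.1 z.2 <= `|g z.2 - g z.1 - lin L z.1 z.2|])).
  apply: measurableI; first exact: measurableX.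
  apply: measurableI.
    exact: (measurable_lt_set (f := cst 0) (measurable_cst _) md).
  apply: measurable_le_set; first exact: measurable_funM.
  by apply: measurableT_comp => //; apply: measurable_funB => //; exact: measurable_funB.
apply/seteqP; split => z.
  by move=> [S1 S2 h1 h2]; split => //; split => //=; rewrite /g !patchE !mem_set.
by move=> [[S1 S2] [h1 /=]]; rewrite /g !patchE !mem_set// => h2; split.
Qed.

Let xsection_pairs L c x : S x -> xsection (pairs L c) x = bad S f L c x.
Proof.
move=> Sx; apply/seteqP; split=> y; rewrite /xsection/= inE.
  by move=> [].
by move=> [].
Qed.

Lemma measurable_bad L c x : S x -> measurable (bad S f L c x).
Proof. by move=> Sx; rewrite -xsection_pairs//; exact: measurable_xsection. Qed.

Lemma measurable_near_affine L c m : measurable (near_affine S f L c m).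
Proof.
pose W n := pairs L c `&` [set z | ball z.1 (half n) (z.2 : R * R)].
have mW n : measurable (W n).
  apply: measurableI => //.
  rewrite (_ : [set z | _] = [set z | `|z.1.1 - z.2.1| < half n] `&`
     [set z | `|z.1.2 - z.2.2| < half n]) //.
  by apply: measurableI; apply: (measurable_lt_set _ (measurable_cst _));
     apply: measurableT_comp => //; exact: measurable_funB.
have mH n := measurable_fun_xsection (@leb2 R) (mW n).
rewrite (_ : near_affine _ _ _ _ _ = S `&` \bigcap_(n in [set n | (m <= n)%N])
    ((leb2 \o xsection (W n)) @^-1` `]-oo, (c / 16 * half n ^+ 2)%:E]%classic)).
  apply: measurableI => //; apply: bigcap_measurable; [by exists m => /=|move=> n mn].
  rewrite -[X in measurable X]setTI; apply: mH => //.
  exact: emeasurable_itv.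
have E x n : S x -> xsection (W n) x = bad S f L c x `&` ball x (half n).
  move=> Sx; rewrite -xsection_pairs//; apply/seteqP; split=> y; rewrite /xsection/= !inE.
    by move=> [].
  by move=> [].
apply/seteqP; split=> x [Sx h]; split => // n mn.
  by have := h n mn; rewrite /= in_itv/= E.
by have := h n mn; rewrite /= in_itv/= E.
Qed.

Lemma bad_le L L' c c' x : `|L.1 - L'.1| <= c' - c -> `|L.2 - L'.2| <= c' - c ->
  bad S f L' c' x `<=` bad S f L c x.
Proof.
move=> h1 h2 y [Sy d0 h]; split => //.
have hl := @lin_le _ (L.1 - L'.1, L.2 - L'.2) x y _ h1 h2.
have e : f y - f x - lin L' x y =
   (f y - f x - lin L x y) + lin (L.1 - L'.1, L.2 - L'.2) x y by rewrite /lin/=; ring.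
by move: h; rewrite e => h; have := ler_normD (f y - f x - lin L x y)
   (lin (L.1 - L'.1, L.2 - L'.2) x y); lra.
Qed.

Lemma not_badP L c x y : S y -> ~ bad S f L c x y ->
  `|f y - f x - lin L x y| <= c * dist1 x y.
Proof.
move=> Sy nb; have [d0|d0] := ltP 0 (dist1 x y).
  by rewrite leNgt; apply/negP => h; apply: nb; split => //; exact: ltW.
rewrite (dist1_eq0 d0) /lin /dist1 !subrr !mulr0 addr0 subr0 normr0.
by rewrite addr0 mulr0.
Qed.

Let leb2_bad_fin x L c n : S x -> leb2 (bad S f L c x `&` ball x (half n)) \is a fin_num.
Proof.
move=> Sx; rewrite ge0_fin_numE//; apply: (@le_lt_trans _ _ (leb2 (ball x (half n)))).
  apply: le_leb2; [apply: measurableI; [exact: measurable_bad|]| |exact: subIsetr];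
  exact: measurable_plane_ball.
by rewrite leb2_ball ?ltry// ltW// half_gt0.
Qed.

(** The two affine functions are compared at a point [y] that is bad for neither, chosen near a
    corner of the ball where both terms of the linear form of slope [L - L'] are nonnegative, so
    that nothing cancels. *)
Lemma slope_unique L L' c c' x m : 0 <= c -> 0 <= c' -> S x ->
    ball x (half m) `<=` (Q : set (R * R)) ->
    (leb2 (bad S f L c x `&` ball x (half m)) < (8^-1 * half m ^+ 2)%:E)%E ->
    (leb2 (bad S f L' c' x `&` ball x (half m)) <= (8^-1 * half m ^+ 2)%:E)%E ->
  `|L.1 - L'.1| + `|L.2 - L'.2| <= 4 * (c + c').
Proof.
move=> c0 c0' Sx bQ h1 h2.
have r0 := @half_gt0 R m; set r := half m in r0 bQ h1 h2 *.
pose sg (t : R) : R := if 0 <= t then 1 else -1.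
have sgE (t : R) : sg t * t = `|t|.
  by rewrite /sg; case: ger0P => ?; rewrite ?mul1r ?mulN1r.
have sg1 t : `|sg t| = 1 by rewrite /sg; case: ifP; rewrite ?normrN normr1.
pose s1 := sg (L.1 - L'.1); pose s2 := sg (L.2 - L'.2).
(* The ball of radius [r / 4] around [p] stays in the ball around [x], and in it each coordinate
   differs from that of [x] by at least [r / 2] in the chosen direction. Its measure [r ^+ 2 / 4] is
   what the two bounds [8^-1 * r ^+ 2], one of them strict, fail to fill. *)
pose p : R * R := (x.1 + s1 * (3 / 4 * r), x.2 + s2 * (3 / 4 * r)).
have sub : ball p (r / 4) `<=` ball x r.
  have key (t s q : R) : `|s| = 1 -> `|t + s * (3 / 4 * r) - q| < r / 4 -> `|t - q| < r.
    move=> s1' h; have -> : t - q = (t + s * (3 / 4 * r) - q) - s * (3 / 4 * r) by ring.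
    apply: le_lt_trans (ler_normB _ _) _.
    by rewrite normrM s1' mul1r gtr0_norm; lra.
  by move=> y [/= y1 y2]; split; rewrite /ball/=; [apply: key y1|apply: key y2]; exact: sg1.
have mB M e : measurable (bad S f M e x `&` ball x r).
  by apply: measurableI; [exact: measurable_bad|exact: measurable_plane_ball].
have r40 : 0 <= r / 4 by lra.
have h1' : (leb2 (bad S f L c x `&` ball x r) <=
    (fine (leb2 (bad S f L c x `&` ball x r)))%:E)%E by rewrite fineK// leb2_bad_fin.
have h12 : fine (leb2 (bad S f L c x `&` ball x r)) + 8^-1 * r ^+ 2 < 4 * (r / 4) ^+ 2.
  by move: h1; rewrite -{1}(fineK (leb2_bad_fin L c m Sx)) lte_fin; lra.
have [y [py Sy nb1 nb2]] := exists_good_point mS nullS r40 (subset_trans sub bQ)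
  (mB L c) (mB L' c') h1' h2 h12.
have xy := sub _ py.
have {}nb1 : `|f y - f x - lin L x y| <= c * dist1 x y.
  by apply: not_badP => // h; apply: nb1.
have {}nb2 : `|f y - f x - lin L' x y| <= c' * dist1 x y.
  by apply: not_badP => // h; apply: nb2.
have dxy := dist1_ball xy.
have d0 := dist1_ge0 x y.
have : `|lin (L.1 - L'.1, L.2 - L'.2) x y| <= (c + c') * (2 * r).
  have -> : lin (L.1 - L'.1, L.2 - L'.2) x y =
    (f y - f x - lin L' x y) - (f y - f x - lin L x y) by rewrite /lin/=; ring.
  apply: le_trans (ler_normB _ _) _.
  apply: le_trans (lerD nb2 nb1) _; rewrite -mulrDl [c' + c]addrC.
  by rewrite ler_wpM2l ?addr_ge0// ltW.
move: py => [/= p1 p2].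
have key (t s q : R) : `|t + s * (3 / 4 * r) - q| < r / 4 -> (s = 1 \/ s = -1) ->
    r / 2 <= s * (q - t).
  by move=> h [] e; move: h; rewrite e ltr_norml => /andP[? ?]; lra.
have sgP t : sg t = 1 \/ sg t = -1 by rewrite /sg; case: ifP; [left|right].
have k1 := key _ _ _ p1 (sgP _); have k2 := key _ _ _ p2 (sgP _).
have e1 : (L.1 - L'.1) * (y.1 - x.1) = `|L.1 - L'.1| * (s1 * (y.1 - x.1)).
  rewrite -sgE -/s1; have : s1 * s1 = 1 by case: (sgP (L.1 - L'.1)) => e; rewrite /s1 e; ring.
  by move=> e; rewrite -[LHS]mul1r -e; ring.
have e2 : (L.2 - L'.2) * (y.2 - x.2) = `|L.2 - L'.2| * (s2 * (y.2 - x.2)).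
  rewrite -sgE -/s2; have : s2 * s2 = 1 by case: (sgP (L.2 - L'.2)) => e; rewrite /s2 e; ring.
  by move=> e; rewrite -[LHS]mul1r -e; ring.
rewrite /lin /= e1 e2 => h.
have := le_trans (ler_norm _) h.
have n1 := normr_ge0 (L.1 - L'.1); have n2 := normr_ge0 (L.2 - L'.2).
rewrite -/s1 in k1; rewrite -/s2 in k2 => {}h.
have g1 : `|L.1 - L'.1| * (r / 2) <= `|L.1 - L'.1| * (s1 * (y.1 - x.1)) by rewrite ler_wpM2l.
have g2 : `|L.2 - L'.2| * (r / 2) <= `|L.2 - L'.2| * (s2 * (y.2 - x.2)) by rewrite ler_wpM2l.
rewrite -(ler_pM2r r0); lra.
Qed.

End NearAffine.

Definition slope {R : realType} (L : 'rV[R]_2) : R * R := (L 0 0, L 0 1).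

Section ApproximateGradient.
Context {R : realType} (S : set (plane R)) (f : R * R -> R).
Hypothesis mS : measurable S.
Hypothesis SQ : S `<=` (Q : set (plane R)).
Hypothesis nullS : leb2 ((Q : set (plane R)) `\` S) = 0%E.
Hypothesis openS : forall x, S x -> exists m, ball x (half m) `<=` (Q : set (R * R)).
Hypothesis mf : measurable_fun S (f : plane R -> R).
Hypothesis cf : forall x, S x -> forall e : R, 0 < e -> exists2 d : R, 0 < d &
  forall y, S y -> ball x d y -> `|f y - f x| < e.
Implicit Types (x y : R * R) (L : 'rV[R]_2) (M : R * R).

(** A third point [y], good for both [x] and [x'], is taken at the scale [half n] comparable to
    their distance [d], and the two affine estimates are subtracted. Here
    [dist1 x y < half n < 4 * d] and [dist1 x' y < 2 * half n < 8 * d], whence the 12. *)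
Lemma near_affine_lip M (c : R) m x x' : 0 < c -> c <= 1 ->
    ball x (half m) `<=` (Q : set (R * R)) ->
    near_affine S f M c m x -> near_affine S f M c m x' -> dist1 x x' <= half m.+1 ->
  `|f x' - f x - lin M x x'| <= 12 * c * dist1 x x'.
Proof.
move=> c0 c1 bQ [Sx hx] [Sx' hx'] dm.
have [d0|d0] := ltP 0 (dist1 x x'); last first.
  rewrite (dist1_eq0 d0) /lin /dist1 !subrr !mulr0 addr0 subr0 normr0.
  by rewrite addr0 mulr0.
have [n [mn dn nd]] := half_between d0 dm.
have r0 := @half_gt0 R n.
have mB z : S z -> measurable (bad S f M c z `&` ball z (half n)).
  by move=> Sz; apply: measurableI; [exact: measurable_bad|exact: measurable_plane_ball].
have bQ' : ball x (half n.+1) `<=` (Q : set (R * R)).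
  apply: subset_trans bQ; apply: le_ball; apply: half_le.
  exact: (leq_trans mn (leqnSn n)).
have hn1 := halfS (R := R) n.
have h12 : c / 16 * half n ^+ 2 + c / 16 * half n ^+ 2 < 4 * half n.+1 ^+ 2.
  rewrite hn1; have : 0 < half n ^+ 2 :> R by rewrite exprn_gt0.
  by nra.
have [y [xy Sy nb nb']] := exists_good_point mS nullS (ltW (@half_gt0 R n.+1)) bQ'
  (mB _ Sx) (mB _ Sx') (hx _ mn) (hx' _ mn) h12.
have x'y : ball x' (half n) y.
  move: xy dn => [/=]; rewrite /ball/= /dist1 hn1 => h1 h2 h3.
  have n1 := normr_ge0 (x'.1 - x.1); have n2 := normr_ge0 (x'.2 - x.2).
  split; rewrite /ball/=.
    by have := ler_distD x.1 x'.1 y.1; lra.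
  by have := ler_distD x.2 x'.2 y.2; lra.
have xy' : ball x (half n) y by apply: le_ball xy; lra.
have {}nb : `|f y - f x - lin M x y| <= c * dist1 x y.
  by apply: (not_badP Sy) => h; apply: nb; split.
have {}nb' : `|f y - f x' - lin M x' y| <= c * dist1 x' y.
  by apply: (not_badP Sy) => h; apply: nb'; split.
have d1 := dist1_ball xy; have d2 := dist1_ball x'y.
have -> : f x' - f x - lin M x x' =
    (f y - f x - lin M x y) - (f y - f x' - lin M x' y) by rewrite /lin; ring.
apply: le_trans (ler_normB _ _) _.
apply: le_trans (lerD nb nb') _.
rewrite -mulrDr [12 * c]mulrC -mulrA ler_pM2l//; lra.
Qed.

(** On [S] the approximate limit [z] must be [f x]: otherwise, by continuity relative to [S], the
    set where [f] stays at least half of [|z - f x|] away from [z] fills small balls up to a null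
    set. What remains is a change of norm, since [dist2 <= dist1 <= 2 * dist2]. *)
Lemma ap_differentialP x L : S x -> ap_differential f x L <->
  forall c k : R, 0 < c -> 0 < k -> exists m, forall n, (m <= n)%N ->
    (leb2 (bad S f (slope L) c x `&` ball x (half n)) <= (k * half n ^+ 2)%:E)%E.
Proof.
move=> Sx.
have mg : measurable_fun setT (f \_ S : plane R -> R) by exact/(measurable_restrictT f mS).
have md := measurable_dist2 x.
have ml : measurable_fun setT (fun y : plane R => lin (slope L) x y).
  by apply: measurable_funD; apply: measurable_funM => //; apply: measurable_funB => //;
    first [exact: measurable_fst2|exact: measurable_snd2].
pose E0 z (eps : R) : set (R * R) := Q `&` [set y | eps <= `|f y - z|].
have mE0 z eps : measurable ((E0 z eps : set (plane R)) `&` S).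
  rewrite (_ : _ `&` _ = S `&` [set y | eps <= `|(f \_ S) y - z|]).
    apply: measurableI => //; apply: (measurable_le_set (measurable_cst _)).
    by apply: measurableT_comp => //; exact: measurable_funB.
  apply/seteqP; split => y; first by move=> [[Qy h] Sy]; split=> //=; rewrite patchE mem_set.
  by move=> [Sy]; rewrite /= patchE mem_set// => h; split => //; split => //; exact: SQ.
pose E1 z (eps : R) : set (R * R) := Q `&` [set y |
  eps <= `| `|f y - z - (L 0 0 * (y.1 - x.1) + L 0 1 * (y.2 - x.2))| / dist2 y x - 0|].
have E1E z eps y : 0 < eps -> (E1 z eps `&` S) y <->
    [/\ S y, 0 < dist2 y x & eps * dist2 y x <= `|f y - z - lin (slope L) x y|].
  move=> eps0; rewrite /E1 /=.
  have d0 : 0 <= dist2 y x by exact: sqrtr_ge0.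
  rewrite subr0 ger0_norm ?divr_ge0//.
  split.
    move=> [[Qy h] Sy].
    have dp : 0 < dist2 y x.
      rewrite lt_neqAle d0 andbT eq_sym; apply/eqP => e; move: h.
      by rewrite e invr0 mulr0 leNgt eps0.
    by split => //; rewrite -ler_pdivlMr.
  by move=> [Sy dp h]; split => //; split; [exact: SQ|rewrite ler_pdivlMr].
have mE1 z eps : 0 < eps -> measurable ((E1 z eps : set (plane R)) `&` S).
  move=> eps0.
  rewrite (_ : _ `&` _ = S `&` ([set y | 0 < dist2 y x] `&`
    [set y | eps * dist2 y x <= `|(f \_ S) y - z - lin (slope L) x y|])).
    apply: measurableI => //; apply: measurableI.
      exact: (measurable_lt_set (measurable_cst _) md).
    apply: measurable_le_set; first exact: measurable_funM.
    by apply: measurableT_comp => //; apply: measurable_funB => //; exact: measurable_funB.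
  apply/seteqP; split => y.
    move=> /(E1E _ _ _ eps0)[Sy dp h]; split => //; split => //=.
    by rewrite patchE mem_set.
  move=> [Sy [dp]]; rewrite /= patchE mem_set// => h.
  by apply/(E1E _ _ _ eps0).
have dens (E : set (R * R)) := @density0P _ S mS nullS E x.
have mB c : measurable (bad S f (slope L) c x) by exact: measurable_bad.
have b1 eps c : 0 < eps -> 2 * c <= eps -> E1 (f x) eps `&` S `<=` bad S f (slope L) c x.
  move=> eps0 ce y /(E1E _ _ _ eps0)[Sy dp h]; split => //.
    by apply: lt_le_trans (dist2_le_dist1 _ _).
  apply: le_trans h; have := dist1_le_dist2 x y; have := dist1_ge0 x y => h1 h2.
  apply: (@le_trans _ _ (eps / 2 * dist1 x y)); first by rewrite ler_wpM2r//; lra.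
  by rewrite mulrAC -mulrA ler_wpM2l//; lra.
have b2 c : 0 < c -> bad S f (slope L) c x `<=` E1 (f x) c `&` S.
  move=> c0 y [Sy dp h]; apply/(E1E _ _ _ c0); split => //.
    by have := dist1_le_dist2 x y; lra.
  by apply: le_trans h; rewrite ler_pM2l// dist2_le_dist1.
split.
  move=> [z [z1 z2]] c k c0 k0.
  have zE : z = f x.
    apply/eqP/negP => /negP zf.
    have e0 : 0 < `|z - f x| / 2 by rewrite divr_gt0// normr_gt0 subr_eq0.
    have [d d0 hd] := cf Sx e0.
    have /dens := z1 _ e0.
    case/(_ (@subIsetl _ _ _) (mE0 _ _))/(_ 1 ltr01) => m hm.
    have [n hn] := half_lt d0.
    have [m' hm'] := openS Sx.
    pose N := maxn m (maxn n m').
    have := hm N (leq_maxl _ _).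
    apply/negP; rewrite -ltNge mul1r.
    apply: (@lt_le_trans _ _ (leb2 (ball x (half N)))).
      by rewrite leb2_ball ?ltW ?half_gt0// lte_fin; have := @half_gt0 R N; nra.
    have mQS : measurable ((Q : set (plane R)) `\` S).
      by apply: measurableD => //; exact: measurable_Q.
    have mEb : measurable ((E0 z (`|z - f x| / 2) : set (plane R)) `&` S `&` ball x (half N)).
      by apply: measurableI => //; exact: measurable_plane_ball.
    apply: (@le_trans _ _ (leb2 (((Q : set (plane R)) `\` S) `|`
        ((E0 z (`|z - f x| / 2) : set (plane R)) `&` S `&` ball x (half N))))).
      apply: le_leb2; [exact: measurable_plane_ball|exact: measurableU|].
      move=> y xy.
      have Qy : Q y.
        apply: hm'; apply: le_ball xy; apply: half_le.
        by rewrite /N !leq_max leqnn !orbT.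
      have [Sy|nSy] := pselect (S y); last by left.
      right; split => //; split => //; split => //=.
      have := hd y Sy; have /[swap]/[apply] : ball x d y.
        apply: le_ball xy; apply: le_trans (ltW hn); apply: half_le.
        by rewrite /N !leq_max leqnn !orbT.
      by have := ler_distD (f y) z (f x); rewrite [`|z - f y|]distrC; lra.
    by apply: (le_trans (measureU2 _ _ _)) => //; rewrite /= nullS add0e.
  rewrite zE in z2.
  have /dens := z2 _ c0.
  case/(_ (@subIsetl _ _ _) (mE1 _ _ c0))/(_ _ k0) => m hm.
  exists m => n /hm; apply: le_trans; apply: le_leb2.
  - by apply: measurableI; [exact: mB|exact: measurable_plane_ball].
  - by apply: measurableI; [exact: mE1|exact: measurable_plane_ball].
  - by apply: setSI; exact: b2.
move=> h; exists (f x); split => eps eps0.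
  apply/(dens _ (@subIsetl _ _ _) (mE0 _ _)) => k k0.
  have [d d0 hd] := cf Sx eps0.
  have [m hm] := half_lt d0; exists m => n mn.
  rewrite (_ : _ `&` _ = set0).
    by rewrite measure0 lee_fin mulr_ge0// ?ltW// exprn_gt0// half_gt0.
  rewrite -subset0 => y [[[Qy /=]] e Sy] xy.
  have := hd y Sy; have /[swap]/[apply] : ball x d y.
    by apply: le_ball xy; apply: le_trans (ltW hm); exact: half_le.
  by rewrite ltNge e.
apply/(dens _ (@subIsetl _ _ _) (mE1 _ _ eps0)) => k k0.
have [m hm] := h (eps / 2) k (divr_gt0 eps0 (ltr0n R 2)) k0.
exists m => n /hm; apply: le_trans; apply: le_leb2.
- by apply: measurableI; [exact: mE1|exact: measurable_plane_ball].
- by apply: measurableI; [exact: mB|exact: measurable_plane_ball].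
- by apply: setSI; apply: b1 => //; lra.
Qed.

End ApproximateGradient.

(** * Measurability of the approximate gradient *)

Definition recip {R : realType} (k : nat) : R := k.+1%:R^-1.

Definition ratr2 {R : realType} (q : rat * rat) : R * R := (ratr q.1, ratr q.2).

Definition ap_diff_set {R : realType} (S : set (R * R)) (f : R * R -> R) : set (plane R) :=
  [set x | S x /\ exists L, ap_differential f x L].

Section Rational.
Context {R : realType}.

Lemma recip_gt0 k : 0 < recip k :> R. Proof. by rewrite invr_gt0. Qed.

Lemma recip_le1 k : recip k <= 1 :> R. Proof. by rewrite invf_le1// ler1n. Qed.

Lemma recip_lt (e : R) : 0 < e -> exists k, recip k < e.
Proof.
by move=> e0; have [n _ /(_ n (leqnn n)) /= nlt] := near_infty_natSinv_lt (PosNum e0); exists n.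
Qed.

Lemma ratr_approx (t e : R) : 0 < e -> exists q : rat, `|t - ratr q| <= e.
Proof.
move=> e0; have /rat_in_itvoo[q] : t - e < t + e by lra.
rewrite in_itv/= => /andP[h1 h2]; exists q.
by rewrite ler_norml; apply/andP; split; lra.
Qed.

(** Closed intervals on the line that meet pairwise have a common point, for instance the supremum
    of their left ends. *)
Lemma limit_of_close (a e : nat -> R) : (forall k j, `|a k - a j| <= e k + e j) ->
  exists l, forall k, `|a k - l| <= e k.
Proof.
move=> h; pose A := [set a k - e k | k in [set: nat]].
have ubA j : ubound A (a j + e j).
  by move=> _ [k _ <-]; have := le_trans (ler_norm _) (h k j); lra.
have A0 : A !=set0 by exists (a 0%N - e 0%N); exists 0%N.
have hs : has_sup A by split=> //; exists (a 0%N + e 0%N); exact: ubA.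
exists (sup A) => k; rewrite ler_distlC; apply/andP; split.
  by apply: sup_upper_bound => //; exists k.
by apply: ge_sup => //; exact: ubA.
Qed.

End Rational.

Section ApproximateGradient.
Context {R : realType} (S : set (plane R)) (f : R * R -> R).
Hypothesis mS : measurable S.
Hypothesis SQ : S `<=` (Q : set (plane R)).
Hypothesis nullS : leb2 ((Q : set (plane R)) `\` S) = 0%E.
Hypothesis openS : forall x, S x -> exists m, ball x (half m) `<=` (Q : set (R * R)).
Hypothesis mf : measurable_fun S (f : plane R -> R).
Hypothesis cf : forall x, S x -> forall e : R, 0 < e -> exists2 d : R, 0 < d &
  forall y, S y -> ball x d y -> `|f y - f x| < e.
Implicit Types (x y : R * R) (L : 'rV[R]_2) (M : R * R).

Let apP x L := @ap_differentialP _ S f mS SQ nullS openS mf cf x L.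

Lemma near_affine_of_ap_differential x L M (c : R) : S x -> 0 < c ->
    `|L 0 0 - M.1| <= c / 2 -> `|L 0 1 - M.2| <= c / 2 ->
  ap_differential f x L -> exists m, near_affine S f M c m x.
Proof.
move=> Sx c0 h1 h2 /(apP _ Sx)/(_ (c / 2) (c / 16)).
rewrite !divr_gt0// => /(_ isT isT)[m hm].
exists m; split => // n /hm; apply: le_trans; apply: le_leb2.
- by apply: measurableI; [exact: measurable_bad|exact: measurable_plane_ball].
- by apply: measurableI; [exact: measurable_bad|exact: measurable_plane_ball].
- by apply: setSI; apply: bad_le; rewrite /slope/=; lra.
Qed.

Lemma near_affine_slopes x M M' (c c' : R) m m' : 0 < c -> c <= 1 -> 0 < c' -> c' <= 1 ->
    near_affine S f M c m x -> near_affine S f M' c' m' x ->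
  `|M.1 - M'.1| + `|M.2 - M'.2| <= 4 * (c + c').
Proof.
move=> c0 c1 c'0 c'1 [Sx h] [_ h'].
have [m0 bQ] := openS Sx.
pose n := maxn m0 (maxn m m').
have n2 : 0 < half n ^+ 2 :> R by rewrite exprn_gt0// half_gt0.
apply: (@slope_unique _ S f mS nullS mf _ _ _ _ x n (ltW c0) (ltW c'0) Sx).
- by apply: subset_trans bQ; apply: le_ball; apply: half_le; rewrite leq_maxl.
- apply: (@le_lt_trans _ _ (c / 16 * half n ^+ 2)%:E).
    by apply: h; rewrite /n !leq_max leqnn !orbT.
  by rewrite lte_fin ltr_pM2r//; lra.
- apply: (@le_trans _ _ (c' / 16 * half n ^+ 2)%:E).
    by apply: h'; rewrite /n !leq_max leqnn !orbT.
  by rewrite lee_fin ler_pM2r//; lra.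
Qed.

Lemma near_affine_slope x L M (c : R) m : 0 < c -> c <= 1 ->
    ap_differential f x L -> near_affine S f M c m x ->
  `|L 0 0 - M.1| + `|L 0 1 - M.2| <= 8 * c.
Proof.
move=> c0 c1 dL nM; have Sx := nM.1.
have [||m' nL] := @near_affine_of_ap_differential x L (slope L) c Sx c0 _ _ dL.
- by rewrite subrr normr0; lra.
- by rewrite subrr normr0; lra.
by have := near_affine_slopes c0 c1 c0 c1 nL nM; rewrite /slope/=; lra.
Qed.

Lemma ap_differential_unique x L L' : S x ->
  ap_differential f x L -> ap_differential f x L' -> L = L'.
Proof.
move=> Sx dL dL'.
have h : `|L 0 0 - L' 0 0| + `|L 0 1 - L' 0 1| <= 0.
  rewrite leNgt; apply/negP => h0.
  have [k hk] := recip_lt (divr_gt0 h0 (ltr0n R 8)).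
  have := recip_gt0 (R := R) k => k0.
  have [||m nL] := @near_affine_of_ap_differential x L' (slope L') _ Sx k0 _ _ dL'.
  - by rewrite subrr normr0; lra.
  - by rewrite subrr normr0; lra.
  by have := near_affine_slope k0 (recip_le1 k) dL nL; rewrite /slope/=; lra.
have n1 := normr_ge0 (L 0 0 - L' 0 0); have n2 := normr_ge0 (L 0 1 - L' 0 1).
have /normr0_eq0/subr0_eq e1 : `|L 0 0 - L' 0 0| = 0 by lra.
have /normr0_eq0/subr0_eq e2 : `|L 0 1 - L' 0 1| = 0 by lra.
apply/rowP => -[[|[|//]] i2].
  by rewrite (_ : Ordinal i2 = 0)//; exact: val_inj.
by rewrite (_ : Ordinal i2 = 1)//; exact: val_inj.
Qed.

Lemma ap_gradE x L : S x -> ap_differential f x L -> ap_grad f x = L.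
Proof.
by move=> Sx dL; apply: xget_unique => // L' dL'; exact: ap_differential_unique dL' dL.
Qed.

Lemma ap_gradP x : ap_diff_set S f x -> ap_differential f x (ap_grad f x).
Proof. by move=> [Sx [L dL]]; rewrite (ap_gradE Sx dL). Qed.

Lemma ap_grad_out x : S x -> ~ ap_diff_set S f x -> ap_grad f x = 0.
Proof.
move=> Sx nD; rewrite /ap_grad; case: xgetP => // L _ dL.
by exfalso; apply: nD; split=> //; exists L.
Qed.

Lemma ap_diff_set_near_affine x k : ap_diff_set S f x -> exists q m,
  [/\ near_affine S f (ratr2 q) (recip k) m x,
    `|ap_grad f x 0 0 - ratr q.1| <= recip k / 2 & `|ap_grad f x 0 1 - ratr q.2| <= recip k / 2].
Proof.
move=> Dx; have dx := ap_gradP Dx; have Sx := Dx.1.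
have k0 := recip_gt0 (R := R) k.
have k20 : 0 < recip k / 2 :> R by lra.
have [q1 h1] := ratr_approx (ap_grad f x 0 0) k20.
have [q2 h2] := ratr_approx (ap_grad f x 0 1) k20.
have [m hm] := @near_affine_of_ap_differential x _ (ratr2 (q1, q2)) _ Sx k0 h1 h2 dx.
by exists (q1, q2), m.
Qed.

(** A Cauchy criterion: slopes that fit at the same point with accuracies [recip k] and [recip j]
    differ by at most [4 * (recip k + recip j)], so they have a limit, and this limit is the
    approximate differential. *)
Lemma ap_diff_setE : ap_diff_set S f = S `&`
  \bigcap_k \bigcup_(i : (rat * rat) * nat) near_affine S f (ratr2 i.1) (recip k) i.2.
Proof.
apply/seteqP; split=> [x Dx|x [Sx h]].
  split; first exact: Dx.1.
  by move=> k _; have [q [m [h _ _]]] := ap_diff_set_near_affine k Dx; exists (q, m).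
have {h} /choice[i hi] : forall k, exists i : (rat * rat) * nat,
    near_affine S f (ratr2 i.1) (recip k) i.2 x.
  by move=> k; have [i _ hi] := h k I; exists i.
pose e (k : nat) : R := 4 * recip k.
have sl k j := near_affine_slopes (recip_gt0 k) (recip_le1 k) (recip_gt0 j) (recip_le1 j) (hi k) (hi j).
have [a ha] : exists a, forall k, `|(ratr2 (i k).1).1 - a| <= e k.
  apply: limit_of_close => k j; have := sl k j.
  by have := normr_ge0 ((ratr2 (R:=R) (i k).1).2 - (ratr2 (i j).1).2); rewrite /e; lra.
have [b hb] : exists b, forall k, `|(ratr2 (i k).1).2 - b| <= e k.
  apply: limit_of_close => k j; have := sl k j.
  by have := normr_ge0 ((ratr2 (R:=R) (i k).1).1 - (ratr2 (i j).1).1); rewrite /e; lra.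
pose L : 'rV[R]_2 := \row_(j < 2) [:: a; b]`_j.
have La : L 0 0 = a by rewrite mxE.
have Lb : L 0 1 = b by rewrite mxE.
split => //; exists L; apply/(apP _ Sx) => c k c0 k0.
(* The limit slope is within [4 * recip j] of the rational one, so [bad_le] asks for
   [5 * recip j <= c]; the 16 comes from the definition of [near_affine]. *)
have mx0 : 0 < Num.min (c / 5) (k * 16) by rewrite lt_min divr_gt0//= mulr_gt0.
have [j] := recip_lt mx0; rewrite lt_min => /andP[j1 j2].
exists (i j).2 => n mn.
apply: (@le_trans _ _ (recip j / 16 * half n ^+ 2)%:E); last first.
  by rewrite lee_fin ler_pM2r ?exprn_gt0 ?half_gt0//; lra.
apply: le_trans ((hi j).2 n mn); apply: le_leb2.
- by apply: measurableI; [exact: measurable_bad|exact: measurable_plane_ball].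
- by apply: measurableI; [exact: measurable_bad|exact: measurable_plane_ball].
- apply: setSI; apply: bad_le; rewrite /slope /= ?La ?Lb.
    by have := ha j; rewrite /e /=; lra.
  by have := hb j; rewrite /e /=; lra.
Qed.

Lemma measurable_ap_diff_set : measurable (ap_diff_set S f).
Proof.
rewrite ap_diff_setE; apply: measurableI => //.
apply: bigcapT_measurable => k; apply: countable_bigcupT_measurable => [|i]; first exact: countableP.
exact: measurable_near_affine.
Qed.

Lemma measurable_ap_grad (j : 'I_2) : measurable_fun S (fun x : plane R => ap_grad f x 0 j : R).
Proof.
have mD := measurable_ap_diff_set.
set D := ap_diff_set S f in mD.
have DS : D `<=` S by move=> x [].
rewrite -(setDUK DS); apply/measurable_funU; [exact: mD|exact: measurableD|].
split; last first.
  apply: (@eq_measurable_fun _ _ (plane R) R (S `\` D) (cst 0)) => [x|]; last exact: measurable_cst.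
  by rewrite inE => -[Sx nD]; rewrite ap_grad_out ?mxE.
pose pr (M : R * R) : R := if j == 0 then M.1 else M.2.
have prE x q : `|ap_grad f x 0 j - pr q| = if j == 0 then `|ap_grad f x 0 0 - q.1| else `|ap_grad f x 0 1 - q.2|.
  rewrite /pr; case: eqP => [->//|/eqP j0]; rewrite (_ : j = 1)//.
  apply: val_inj => /=; move: j0; rewrite -val_eqE /=.
  by have := ltn_ord j; case: (nat_of_ord j) => [|[|]].
move=> _; apply: (measurability _ (@RGenCInfty.measurableE R)) => //.
move=> _ [_ [a ->] <-].
(* The component is at least [a] exactly when, at every accuracy [recip k], some rational slope that
   fits has its component at least [a - recip k]. *)
rewrite (_ : _ `&` _ = D `&` \bigcap_k \bigcup_(i : (rat * rat) * nat)
    (if `[< a - recip k <= pr (ratr2 i.1) >]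
     then near_affine S f (ratr2 i.1) (recip k) i.2 else set0)).
  apply: measurableI => //; apply: bigcapT_measurable => k.
  apply: countable_bigcupT_measurable => [|i]; first exact: countableP.
  case: asboolP => // _.
  exact: measurable_near_affine.
apply/seteqP; split=> x [Dx]; rewrite /= ?in_itv/= ?andbT => h; split => //.
  move=> k _; have [q [m [hn h1 h2]]] := ap_diff_set_near_affine k Dx.
  exists (q, m) => //=; case: asboolP => // -[].
  have : `|ap_grad f x 0 j - pr (ratr2 q)| <= recip k / 2 by rewrite prE; case: ifP.
  by rewrite ler_norml => /andP[? ?]; have := recip_gt0 (R := R) k; lra.
rewrite leNgt; apply/negP => lta.
(* A fitting slope is within [8 * recip k] of the gradient, and a further [recip k] is lost in the
   comparison with [a]. *)
have ax0 : 0 < (a - ap_grad f x 0 j) / 9 by lra.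
have [k hk] := recip_lt ax0.
have [i _] := h k I; case: asboolP => // h1 /(near_affine_slope (recip_gt0 k) (recip_le1 k) (ap_gradP Dx)).
have n1 := normr_ge0 (ap_grad f x 0 0 - (ratr2 i.1).1).
have n2 := normr_ge0 (ap_grad f x 0 1 - (ratr2 i.1).2).
have : `|ap_grad f x 0 j - pr (ratr2 i.1)| <= 
   `|ap_grad f x 0 0 - (ratr2 i.1).1| + `|ap_grad f x 0 1 - (ratr2 i.1).2|.
  by rewrite prE; case: ifP => _; lra.
have := ler_norm (- (ap_grad f x 0 j - pr (ratr2 i.1))); rewrite normrN.
by lra.
Qed.

End ApproximateGradient.

(** * Integrability of Jacobians *)

Section Jacobian.
Context {R : realType} (S : set (plane R)).
Hypothesis mS : measurable S.
Hypothesis Sint : S `<=` open_square.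
Hypothesis nullS : leb2 ((Q : set (plane R)) `\` S) = 0%E.
Implicit Types (x y : R * R) (M : R * R).

Definition inner (m : nat) : set (plane R) :=
  `[half m, 1 - half m]%classic `*` `[half m, 1 - half m]%classic.

Let SQ : S `<=` (Q : set (plane R)) := subset_trans Sint (@open_square_subQ R).

Let inner_ball m x : inner m x -> ball x (half m) `<=` (Q : set (R * R)).
Proof.
move=> [/=]; rewrite !in_itv/= => /andP[? ?] /andP[? ?] y [].
rewrite /ball/= !ltr_distlC => /andP[? ?] /andP[? ?].
by split; rewrite /= in_itv/=; apply/andP; split; lra.
Qed.

Let inner_mono m n : (m <= n)%N -> inner m `<=` inner n.
Proof.
move=> mn x [/=]; have := half_le (R := R) mn; rewrite !in_itv/= => h.
move=> /andP[? ?] /andP[? ?]; split; rewrite /= in_itv/=; apply/andP; split; lra.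
Qed.

Let inner_ex x : S x -> exists m, inner m x.
Proof.
move=> /Sint[/andP[a0 a1] /andP[b0 b1]].
have e0 : 0 < Num.min (Num.min x.1 (1 - x.1)) (Num.min x.2 (1 - x.2)).
  by rewrite !lt_min a0 b0 !subr_gt0 a1 b1.
have [m] := half_lt e0; rewrite !lt_min => /andP[/andP[? ?] /andP[? ?]].
by exists m; split; rewrite /= in_itv/=; apply/andP; split; lra.
Qed.

Lemma open_of_inner x : S x -> exists m, ball x (half m) `<=` (Q : set (R * R)).
Proof. by move=> /inner_ex[m /inner_ball]; exists m. Qed.

Lemma near_affine_mono f M (c : R) m n : (m <= n)%N ->
  near_affine S f M c m `<=` near_affine S f M c n.
Proof.
by move=> mn x [Sx h]; split=> // j nj; apply: h; exact: leq_trans nj.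
Qed.

Variables f1 f2 : R * R -> R.
Hypothesis mf1 : measurable_fun S (f1 : plane R -> R).
Hypothesis mf2 : measurable_fun S (f2 : plane R -> R).
Hypothesis cf1 : forall x, S x -> forall e : R, 0 < e -> exists2 d : R, 0 < d &
  forall y, S y -> ball x d y -> `|f1 y - f1 x| < e.
Hypothesis cf2 : forall x, S x -> forall e : R, 0 < e -> exists2 d : R, 0 < d &
  forall y, S y -> ball x d y -> `|f2 y - f2 x| < e.

Definition jac2 x : R :=
  ap_grad f1 x 0 0 * ap_grad f2 x 0 1 - ap_grad f1 x 0 1 * ap_grad f2 x 0 0.

Lemma measurable_jac2 : measurable_fun S (jac2 : plane R -> R).
Proof.
have g1 := measurable_ap_grad mS SQ nullS open_of_inner mf1 cf1.
have g2 := measurable_ap_grad mS SQ nullS open_of_inner mf2 cf2.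
apply: measurable_funB; apply: measurable_funM; [exact: g1|exact: g2|exact: g1|exact: g2].
Qed.

Let idx : Type := ((nat * nat) * ((rat * rat) * (rat * rat)) * (int * int))%type.

Let det (q : (rat * rat) * (rat * rat)) : R :=
  ratr q.1.1 * ratr q.2.2 - ratr q.1.2 * ratr q.2.1.

Let size (q : (rat * rat) * (rat * rat)) : R :=
  `|ratr q.1.1| + `|ratr q.1.2| + (`|ratr q.2.1| + `|ratr q.2.2|).

(** A piece fixes an accuracy [recip k], a scale [m], a rational matrix [q] and a dyadic square. The
    factor 24 is twice the 12 of [near_affine_lip], so that the affine error can be absorbed;
    generation [m.+2] keeps two points of a piece within [half m.+1] in [dist1], the range of that
    lemma. *)
Let piece (E : set (plane R)) (i : idx) : set (plane R) :=
  let: ((k, m), q, z) := i in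
  if `[< det q != 0 /\ 24 * recip k * size q <= `|det q| >] then
    E `&` [set x | `|jac2 x| <= 2 * `|det q|] `&` inner m `&`
    (near_affine S f1 (ratr2 q.1) (recip k) m `&` near_affine S f2 (ratr2 q.2) (recip k) m)
    `&` dyadic_square m.+2 z
  else set0.

Let measurable_piece E i : measurable E -> E `<=` S -> measurable (piece E i).
Proof.
move=> mE ES; case: i => [[[k m] q] z]; rewrite /piece; case: asboolP => // _.
apply: measurableI; last exact: measurable_dyadic_square.
apply: measurableI; last by apply: measurableI; exact: measurable_near_affine.
apply: measurableI; last by apply: measurableX; exact: measurable_itv.
have mj : measurable_fun E (fun x : plane R => `|jac2 x|).
  by apply: measurableT_comp => //; apply: measurable_funS measurable_jac2.
have := mj mE _ (measurable_itv `]-oo, 2 * `|det q|]).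
rewrite (_ : _ @^-1` _ = [set x | `|jac2 x| <= 2 * `|det q|])//.
Qed.

(** Both linear forms are at most [t], which is [s] plus the affine error
    [12 * recip k * dist1 y x]. Inverting the matrix bounds [|det q| * dist1 y x] by [size q * t],
    so the condition on [q] makes that error at most [t / 2]; hence [t <= 2 * s]. *)
Let piece_expand E k m q z : det q != 0 -> 24 * recip k * size q <= `|det q| ->
  forall (x y : R * R) (s : R), piece E ((k, m), q, z) x -> piece E ((k, m), q, z) y ->
      `|f1 x - f1 y| <= s -> `|f2 x - f2 y| <= s ->
      `|ratr q.1.1 * (x.1 - y.1) + ratr q.1.2 * (x.2 - y.2)| <= 2 * s /\
      `|ratr q.2.1 * (x.1 - y.1) + ratr q.2.2 * (x.2 - y.2)| <= 2 * s.
Proof.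
move=> D0 Dk x y s; rewrite /piece; case: asboolP => // _.
move=> [[[_ ix] [n1x n2x]] zx] [[[_ iy] [n1y n2y]] zy] h1 h2.
have k0 := recip_gt0 (R := R) k; have k1 := recip_le1 (R := R) k.
have dyx : dist1 y x <= half m.+1.
  have [e1 e2] : dyadic_index m.+2 x = dyadic_index m.+2 y by rewrite zx zy.
  have := floor_dist e1; have := floor_dist e2.
  by rewrite -exprVn -/(half _) /dist1 halfS; lra.
have L1 := near_affine_lip mS nullS mf1 k0 k1 (inner_ball iy) n1y n1x dyx.
have L2 := near_affine_lip mS nullS mf2 k0 k1 (inner_ball iy) n2y n2x dyx.
move: L1 L2; rewrite /lin /ratr2 /=.
set a : R := ratr q.1.1; set b : R := ratr q.1.2; set c : R := ratr q.2.1; set d : R := ratr q.2.2.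
set v1 := x.1 - y.1; set v2 := x.2 - y.2 => L1 L2.
set t := s + 12 * recip k * dist1 y x.
have A1 : `|a * v1 + b * v2| <= t.
  have -> : a * v1 + b * v2 = (f1 x - f1 y) - (f1 x - f1 y - (a * v1 + b * v2)) by ring.
  by apply: le_trans (ler_normB _ _) _; exact: lerD.
have A2 : `|c * v1 + d * v2| <= t.
  have -> : c * v1 + d * v2 = (f2 x - f2 y) - (f2 x - f2 y - (c * v1 + d * v2)) by ring.
  by apply: le_trans (ler_normB _ _) _; exact: lerD.
have D1 : `|det q| * `|v1| <= (`|d| + `|b|) * t.
  rewrite -normrM.
  have -> : det q * v1 = d * (a * v1 + b * v2) - b * (c * v1 + d * v2).
    by rewrite /det -/a -/b -/c -/d; ring.
  apply: le_trans (ler_normB _ _) _; rewrite !normrM mulrDl.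
  by apply: lerD; apply: ler_wpM2l.
have D2 : `|det q| * `|v2| <= (`|a| + `|c|) * t.
  rewrite -normrM.
  have -> : det q * v2 = a * (c * v1 + d * v2) - c * (a * v1 + b * v2).
    by rewrite /det -/a -/b -/c -/d; ring.
  apply: le_trans (ler_normB _ _) _; rewrite !normrM mulrDl.
  by apply: lerD; apply: ler_wpM2l.
have N0 : 0 < size q.
  have h : 0 <= size q by rewrite /size !addr_ge0.
  rewrite lt_neqAle h andbT eq_sym; apply/eqP => e.
  have := normr_gt0 (det q); rewrite D0 => D0'.
  move: e; rewrite /size -/a -/b -/c -/d => e.
  have na := normr_ge0 a; have nb := normr_ge0 b; have nc := normr_ge0 c; have nd := normr_ge0 d.
  have /normr0_eq0 a0 : `|a| = 0 by lra.
  have /normr0_eq0 b0 : `|b| = 0 by lra.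
  by move: D0'; rewrite /det -/a -/b a0 b0 !mul0r subrr normr0 ltxx.
have key : 24 * recip k * dist1 y x <= t.
  rewrite -(ler_pM2l N0).
  apply: (@le_trans _ _ (`|det q| * dist1 y x)).
    rewrite mulrA [size q * _]mulrC; apply: ler_wpM2r => //; exact: dist1_ge0.
  rewrite /dist1 mulrDr; apply: le_trans (lerD D1 D2) _.
  by rewrite -mulrDl /size -/a -/b -/c -/d le_eqVlt; apply/orP; left; apply/eqP; ring.
have t2 : t <= 2 * s by rewrite /t in key *; lra.
by split; apply: le_trans t2.
Qed.

Lemma jac2_integrable (E : set (plane R)) (G : plane R -> plane R) :
    measurable E -> E `<=` S -> measurable_fun setT G ->
    (forall x, E x -> `|f1 x| <= 1 /\ `|f2 x| <= 1) ->
    (forall x, E x -> G (f1 x, f2 x) = x) ->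
  (\int[leb2]_(x in E) `|jac2 x|%:E < +oo)%E.
Proof.
move=> mE ES mG f1le GF.
pose F : plane R -> plane R := fun x => ((f1 \_ S) x, (f2 \_ S) x).
have FE x : E x -> F x = (f1 x, f2 x) by move=> /ES Sx; rewrite /F !patchE !mem_set.
have mF : measurable_fun setT F.
  have g1 : measurable_fun setT (f1 \_ S : plane R -> R) by exact/(measurable_restrictT f1 mS).
  have g2 : measurable_fun setT (f2 \_ S : plane R -> R) by exact/(measurable_restrictT f2 mS).
  exact: (measurable_fun_pair g1 g2).
pose P n := if @pickle_inv idx n is Some i then piece E i else set0.
apply: (@area_inequality _ E (fun x => `|jac2 x|) F G P mE _ mF mG) => //.
- apply: (@le_lt_trans _ _ (leb2 (ball ((0, 0) : R * R) 2))); last by rewrite leb2_ball ?ltry.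
  apply: le_leb2 => //; first exact: measurable_plane_ball.
  move=> x /ES /Sint[/andP[? ?] /andP[? ?]].
  by split; rewrite /ball/= sub0r normrN gtr0_norm//; lra.
- by apply: measurableT_comp => //; apply: measurable_funS measurable_jac2.
- by move=> x Ex; rewrite FE// GF.
- by move=> x Ex; rewrite FE//; exact: f1le.
- by move=> n; rewrite /P; case: pickle_inv => // i; exact: measurable_piece.
- move=> n x; rewrite /P; case: pickle_inv => // -[[[k m] q] z]; rewrite /piece.
  by case: asboolP => // _ [[[[]]]].
(* Where the Jacobian is nonzero both components are approximately differentiable, the default value
   of [ap_grad] being [0]. *)
- move=> x Ex J0; have Sx := ES _ Ex.
  have nz1 : ap_diff_set S f1 x.
    apply: contrapT => h; move: J0; rewrite /jac2 (ap_grad_out Sx h) !mxE !mul0r subrr.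
    by rewrite normr0 ltxx.
  have nz2 : ap_diff_set S f2 x.
    apply: contrapT => h; move: J0; rewrite /jac2 (ap_grad_out Sx h) !mxE !mulr0 subrr.
    by rewrite normr0 ltxx.
  move: J0; rewrite /jac2.
  set a := ap_grad f1 x 0 0; set b := ap_grad f1 x 0 1.
  set c := ap_grad f2 x 0 0; set d := ap_grad f2 x 0 1 => J0.
  pose N := `|a| + `|b| + (`|c| + `|d|).
  have N0 : 0 <= N by rewrite /N !addr_ge0.
  (* Rounding the four entries costs at most [recip k / 2] each, so [size q <= N + 2], and the
     determinant stays at least half of the Jacobian. With 48 twice the 24 in [piece], the condition
     there follows. *)
  have e0 : 0 < `|a * d - b * c| / (48 * (N + 2)) by rewrite divr_gt0//; lra.
  have [k] := recip_lt e0; rewrite ltr_pdivlMr; last by lra.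
  have k0 := recip_gt0 (R := R) k; have k1 := recip_le1 (R := R) k => ke.
  have [q1 [m1 [n1 hq11 hq12]]] :=
    ap_diff_set_near_affine mS SQ nullS open_of_inner mf1 cf1 k nz1.
  have [q2 [m2 [n2 hq21 hq22]]] :=
    ap_diff_set_near_affine mS SQ nullS open_of_inner mf2 cf2 k nz2.
  have [m3 im3] := inner_ex Sx.
  rewrite -/a in hq11; rewrite -/b in hq12; rewrite -/c in hq21; rewrite -/d in hq22.
  pose m := maxn m1 (maxn m2 m3).
  pose q := (q1, q2).
  have sz : size q <= N + 2.
    have nn (s t : R) : `|s - t| <= recip k / 2 -> `|t| <= `|s| + recip k / 2.
      by move=> h; have := ler_distD s t 0; rewrite !subr0 distrC; lra.
    have := nn _ _ hq11; have := nn _ _ hq12; have := nn _ _ hq21; have := nn _ _ hq22.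
    by rewrite /size /N /q /=; lra.
  have dd : `|(a * d - b * c) - det q| <= recip k * (N + 1) / 2.
    have pd (s t s' t' : R) : `|s - s'| <= recip k / 2 -> `|t - t'| <= recip k / 2 ->
       `|s * t - s' * t'| <= recip k / 2 * (`|s| + `|t| + recip k / 2).
      move=> h h'.
      have -> : s * t - s' * t' = (s - s') * t + s * (t - t') - (s - s') * (t - t') by ring.
      apply: le_trans (ler_normB _ _) _.
      apply: le_trans (lerD (ler_normD _ _) (lexx _)) _.
      rewrite !normrM.
      have g1 : `|s - s'| * `|t| <= recip k / 2 * `|t| by rewrite ler_wpM2r.
      have g2 : `|s| * `|t - t'| <= `|s| * (recip k / 2) by rewrite ler_wpM2l.
      have g3 : `|s - s'| * `|t - t'| <= recip k / 2 * (recip k / 2) by apply: ler_pM.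
      by lra.
    have p1 := pd _ _ _ _ hq11 hq22; have p2 := pd _ _ _ _ hq12 hq21.
    have -> : a * d - b * c - det q = (a * d - ratr q1.1 * ratr q2.2)
       - (b * c - ratr q1.2 * ratr q2.1) by rewrite /det /q /=; ring.
    apply: le_trans (ler_normB _ _) _; apply: le_trans (lerD p1 p2) _.
    by rewrite /N; nra.
  have dd2 : recip k * (N + 1) <= `|a * d - b * c| / 48.
    by rewrite ler_pdivlMr//; nra.
  have Dge : `|a * d - b * c| <= 2 * `|det q|.
    by have := ler_distD 0 (a * d - b * c) (det q); rewrite sub0r subr0 normrN;
      have := ler_distD (det q) (a * d - b * c) 0; rewrite !subr0; lra.
  pose z := dyadic_index m.+2 x.
  exists (@pickle idx ((k, m), q, z)); rewrite /P pickleK_inv /piece.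
  case: asboolP => [_|[]]; last first.
    split; first by rewrite -normr_gt0; lra.
    apply: (@le_trans _ _ (24 * recip k * (N + 2))); last by lra.
    by rewrite ler_wpM2l// mulr_ge0// ltW.
  split => //; split; last first.
    split; [apply: near_affine_mono n1|apply: near_affine_mono n2].
      by rewrite /m leq_maxl.
    by rewrite /m !leq_max leqnn !orbT.
  split; last by apply: inner_mono im3; rewrite /m !leq_max leqnn !orbT.
  by split.
- move=> n; rewrite /P.
  (* Indices that encode no piece, or an empty one, must still exhibit an invertible matrix; the
     identity serves. *)
  have triv : exists a b c d : R, [/\ a * d - b * c != 0,
      forall x : plane R, set0 x -> `|jac2 x| <= 2 * `|a * d - b * c| &
      forall (x y : R * R) (s : R), (set0 : set (plane R)) x -> (set0 : set (plane R)) y ->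
      `|(F x).1 - (F y).1| <= s -> `|(F x).2 - (F y).2| <= s ->
      `|a * (x.1 - y.1) + b * (x.2 - y.2)| <= 2 * s /\
      `|c * (x.1 - y.1) + d * (x.2 - y.2)| <= 2 * s].
    by exists 1, 0, 0, 1; split => //; rewrite mulr1 mulr0 subr0 oner_eq0.
  case: pickle_inv => [[[[k m] q] z]|//].
  have [[D0 Dk]|h] := pselect (det q != 0 /\ 24 * recip k * size q <= `|det q|); last first.
    by rewrite /piece; case: asboolP => // _.
  exists (ratr q.1.1), (ratr q.1.2), (ratr q.2.1), (ratr q.2.2); split => //.
    by move=> x; rewrite /piece; case: asboolP => // _ [[[[]]]].
  have pE x : piece E ((k, m), q, z) x -> E x.
    by rewrite /piece; case: asboolP => // _ [[[[]]]].
  move=> x y s px py; rewrite !FE; [|exact: pE py|exact: pE px].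
  exact: (piece_expand D0 Dk px py).
Qed.

End Jacobian.

(** * Differentiability of convex functions *)

Definition move {R : realType} (x e : R * R) (t : R) : R * R :=
  (x.1 + t * e.1, x.2 + t * e.2).

(* [p] is the derivative of [u] at [x] in the direction [e], and the
   corresponding affine function supports [u] along the line. *)
Definition line_slope {R : realType} (u : R * R -> R) (e x : R * R) (p : R) : Prop :=
  (forall t, Q (move x e t) -> p * t <= u (move x e t) - u x) /\
  forall eps : R, 0 < eps -> exists2 h : R, 0 < h &
    forall t : R, `|t| <= h -> Q (move x e t) /\ u (move x e t) - u x <= p * t + eps * `|t|.

(** A bound on symmetric second differences. For convex [u] the difference quotients are monotone in
    the step, so a single small step for each [k] already forces the one-sided derivatives to agree;
    steps [recip n] make the condition countable, hence measurable. *)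
Definition differentiable_along {R : realType} (u : R * R -> R) (e : R * R) : set (plane R) :=
  [set x | open_square x /\ forall k, exists n,
    [/\ Q (move x e (recip n)), Q (move x e (- recip n)) &
     u (move x e (recip n)) + u (move x e (- recip n)) <= 2 * u x + recip n * recip k]].

Section Convex.
Context {R : realType} (u : R * R -> R).
Hypothesis su : strictly_convex u.
Implicit Types (x y e : R * R) (t : R).

Lemma Q_convex x y t : Q x -> Q y -> 0 <= t <= 1 ->
  Q (t * x.1 + (1 - t) * y.1, t * x.2 + (1 - t) * y.2).
Proof.
move=> [/=]; rewrite !in_itv/= => /andP[? ?] /andP[? ?] [/=].
rewrite !in_itv/= => /andP[? ?] /andP[? ?] /andP[? ?].
by split; rewrite /= in_itv/=; apply/andP; split; nra.
Qed.

Lemma convex_le x y t : Q x -> Q y -> 0 <= t <= 1 ->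
  u (t * x.1 + (1 - t) * y.1, t * x.2 + (1 - t) * y.2) <= t * u x + (1 - t) * u y.
Proof.
move=> Qx Qy /andP[]; rewrite le_eqVlt => /predU1P[<- _|t0].
  by rewrite !mul0r !add0r subr0 !mul1r -surjective_pairing.
rewrite le_eqVlt => /predU1P[->|t1].
  by rewrite subrr !mul0r !addr0 !mul1r -surjective_pairing.
have [->|/eqP xy] := eqVneq x y; last by apply/ltW/su => //; rewrite t0.
have h (a : R) : t * a + (1 - t) * a = a by ring.
by rewrite !h -surjective_pairing.
Qed.

Lemma move0 x e : move x e 0 = x.
Proof. by rewrite /move !mul0r !addr0 -surjective_pairing. Qed.

Lemma move_between x e (s t r : R) : s < t -> s <= r <= t ->
    Q (move x e s) -> Q (move x e t) ->
  Q (move x e r) /\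
  (t - s) * u (move x e r) <= (t - r) * u (move x e s) + (r - s) * u (move x e t).
Proof.
move=> st /andP[sr rt] Qs Qt.
have ts0 : 0 < t - s by lra.
pose l := (t - r) / (t - s).
have l01 : 0 <= l <= 1.
  by rewrite divr_ge0 ?ler_pdivrMr//=; lra.
have E : move x e r = (l * (move x e s).1 + (1 - l) * (move x e t).1,
   l * (move x e s).2 + (1 - l) * (move x e t).2).
  by rewrite /move /l /=; congr pair; field; rewrite gt_eqF.
split; first by rewrite E; exact: Q_convex.
have := convex_le Qs Qt l01; rewrite -E -(ler_pM2l ts0).
suff -> : (t - s) * (l * u (move x e s) + (1 - l) * u (move x e t)) =
  (t - r) * u (move x e s) + (r - s) * u (move x e t) by [].
by rewrite /l; field; rewrite gt_eqF.
Qed.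

Lemma open_square_move x e : open_square x -> `|e.1| <= 1 -> `|e.2| <= 1 ->
  exists n, forall t, `|t| <= recip n -> Q (move x e t).
Proof.
move=> [/andP[a0 a1] /andP[b0 b1]] e1 e2.
have e0 : 0 < Num.min (Num.min x.1 (1 - x.1)) (Num.min x.2 (1 - x.2)).
  by rewrite !lt_min a0 b0 !subr_gt0 a1 b1.
have [n] := recip_lt e0; rewrite !lt_min => /andP[/andP[? ?] /andP[? ?]].
exists n => t tn.
have g1 : `|t * e.1| <= recip n by rewrite normrM; have := normr_ge0 t; nra.
have g2 : `|t * e.2| <= recip n by rewrite normrM; have := normr_ge0 t; nra.
move: g1 g2; rewrite !ler_norml => /andP[? ?] /andP[? ?].
by split; rewrite /= in_itv/=; apply/andP; split; lra.
Qed.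

Section Direction.
Variable e : R * R.
Hypotheses (e1 : `|e.1| <= 1) (e2 : `|e.2| <= 1).
Variable x : R * R.
Hypothesis ox : open_square x.
Let phi t := u (move x e t) - u x.

Let Qx : Q x := open_square_subQ ox.

Let phi_pos s t : 0 < s -> s <= t -> Q (move x e t) ->
  Q (move x e s) /\ phi s / s <= phi t / t.
Proof.
move=> s0 st Qt; have t0 : 0 < t by lra.
have b : 0 <= s <= t by rewrite (ltW s0).
have [|Qs] := move_between t0 b _ Qt; rewrite move0//.
move=> h; split => //; rewrite ler_pdivrMr// mulrAC ler_pdivlMr// /phi; lra.
Qed.

Let phi_neg s t : 0 < s -> s <= t -> Q (move x e (- t)) ->
  Q (move x e (- s)) /\ phi (- s) / s <= phi (- t) / t.
Proof.
move=> s0 st Qt; have t0 : - t < 0 by lra.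
have b : - t <= - s <= 0 by apply/andP; split; lra.
have [|Qs] := move_between t0 b Qt; rewrite move0//.
move=> h; split => //; rewrite ler_pdivrMr// mulrAC ler_pdivlMr; last by lra.
by rewrite /phi; lra.
Qed.

Let phi_opp s t : 0 < s -> 0 < t -> Q (move x e s) -> Q (move x e (- t)) ->
  - (phi (- t) / t) <= phi s / s.
Proof.
move=> s0 t0 Qs Qt; have ts : - t < s by lra.
have b : - t <= 0 <= s by apply/andP; split; lra.
have [_] := move_between ts b Qt Qs.
rewrite move0 => h; rewrite -mulNr ler_pdivrMr// mulrAC ler_pdivlMr// /phi; lra.
Qed.

(** As forward quotients increase with the step, [inf A] is the right derivative along [e]; it also
    dominates every backward quotient. *)
Let A := [set phi t / t | t in [set t | 0 < t /\ Q (move x e t)]].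

Let A0 : A !=set0.
Proof.
have [n hn] := open_square_move ox e1 e2.
exists (phi (recip n) / recip n), (recip n) => //; split; first exact: recip_gt0.
by apply: hn; rewrite gtr0_norm// recip_gt0.
Qed.

Let lbA : has_lbound A.
Proof.
have [n hn] := open_square_move ox e1 e2; have n0 := recip_gt0 (R := R) n.
exists (- (phi (- recip n) / recip n)) => _ [t [t0 Qt] <-].
by apply: phi_opp => //; apply: hn; rewrite normrN gtr0_norm.
Qed.

Let inf_le t : 0 < t -> Q (move x e t) -> inf A <= phi t / t.
Proof. by move=> t0 Qt; apply: ge_inf => //; exists t. Qed.

Let inf_ge t : 0 < t -> Q (move x e (- t)) -> - (phi (- t) / t) <= inf A.
Proof. by move=> t0 Qt; apply: lb_le_inf => // _ [s [s0 Qs] <-]; exact: phi_opp. Qed.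

(** The number [inf A] separates backward from forward quotients, which gives the supporting line. A
    small second difference at [recip n] puts both quotients within [eps] of it there, and
    monotonicity extends this to all smaller steps. *)
Lemma line_slope_ex : differentiable_along u e x -> exists p, line_slope u e x p.
Proof.
move=> [_ dx]; exists (inf A); split.
  move=> t Qt; have [t0|t0|->] := ltgtP t 0.
  - have := @inf_ge (- t); rewrite opprK oppr_gt0 => /(_ t0 Qt).
    by rewrite -mulNr ler_pdivrMr ?oppr_gt0// /phi; lra.
  - by have := inf_le t0 Qt; rewrite ler_pdivlMr.
  - by rewrite move0 subrr mulr0.
move=> eps eps0; have [k ke] := recip_lt eps0.
have [n [Qp Qm hn]] := dx k; have n0 := recip_gt0 (R := R) n.
exists (recip n) => // t.
have hn' : phi (recip n) / recip n + phi (- recip n) / recip n <= eps.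
  rewrite -mulrDl ler_pdivrMr//; apply: (@le_trans _ _ (recip n * recip k)).
    by rewrite /phi; lra.
  by rewrite mulrC ler_pM2r// ltW.
have hp := inf_le n0 Qp; have hm := inf_ge n0 Qm.
have [t0|t0|->] := ltgtP t 0.
- rewrite ltr0_norm// => tn; have t0' : 0 < - t by lra.
  have [] := phi_neg t0' tn Qm; rewrite opprK => Qt h; split => //.
  have : phi t / - t <= eps - inf A by lra.
  by rewrite ler_pdivrMr// /phi; lra.
- rewrite gtr0_norm// => tn.
  have [Qt h] := phi_pos t0 tn Qp; split => //.
  have : phi t / t <= eps + inf A by lra.
  by rewrite ler_pdivrMr// /phi; lra.
- by rewrite move0 subrr normr0 !mulr0 addr0.
Qed.

(* A rational number strictly between the left and the right derivative. *)
Lemma supporting_rat : ~ differentiable_along u e x -> exists q : rat,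
  forall t, t != 0 -> Q (move x e t) -> ratr q * t < u (move x e t) - u x.
Proof.
move=> ndx.
have [k hk] : exists k, forall n, Q (move x e (recip n)) -> Q (move x e (- recip n)) ->
    recip k < phi (recip n) / recip n + phi (- recip n) / recip n.
  apply: contrapT => /forallNP h; apply: ndx; split => // k.
  apply: contrapT => /forallNP h'; apply: (h k) => n Qp Qm.
  rewrite -mulrDl ltr_pdivlMr ?recip_gt0// ltNge; apply/negP => h2.
  by apply: (h' n); split => //; rewrite /phi in h2; lra.
(* Smaller steps bring the forward and backward quotients closer together, so the gap [recip k] at
   some [recip n] below [s] and [t] persists at [s] and [- t]. *)
have gap t : 0 < t -> Q (move x e (- t)) -> - (phi (- t) / t) <= inf A - recip k.
  move=> t0 Qt; rewrite lerBrDr; apply: lb_le_inf => // _ [s [s0 Qs] <-].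
  have m0 : 0 < Num.min s t by rewrite lt_min s0.
  have [n] := recip_lt m0; rewrite lt_min => /andP[/ltW ns /ltW nt].
  have n0 := recip_gt0 (R := R) n.
  have [Qp hp] := phi_pos n0 ns Qs; have [Qm hm] := phi_neg n0 nt Qt.
  by have := hk _ Qp Qm; lra.
have : inf A - recip k < inf A by have := recip_gt0 (R := R) k; lra.
move=> /rat_in_itvoo[q]; rewrite in_itv/= => /andP[q1 q2].
exists q => t; have [t0|t0|//] := ltgtP t 0 => _ Qt.
- have := @gap (- t); rewrite opprK oppr_gt0 => /(_ t0 Qt) h.
  have : - (phi t / - t) < ratr q by lra.
  by rewrite -mulNr ltr_pdivrMr ?oppr_gt0// /phi; lra.
- have h : ratr q < phi t / t by have := inf_le t0 Qt; lra.
  by move: h; rewrite ltr_pdivlMr.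
Qed.

End Direction.

End Convex.

(** * Almost everywhere existence and measurability of the gradient *)

Section ConvexGradient.
Context {R : realType} (u : R * R -> R).
Hypothesis cu : forall x, Q x -> forall eps : R, 0 < eps -> exists2 d : R, 0 < d &
  forall y, Q y -> ball x d y -> `|u y - u x| < eps.
Hypothesis su : strictly_convex u.
Implicit Types (x y e : R * R) (t : R).

Lemma measurable_on_Q : measurable_fun (Q : set (plane R)) (u : plane R -> R).
Proof.
move=> mQ; apply: (measurability _ (@RGenInftyO.measurableE R)) => //.
move=> _ [_ [a ->] <-].
pose I := [set xd : (R * R) * R | forall y, Q y -> ball xd.1 xd.2 y -> u y < a].
rewrite (_ : _ `&` _ = (Q : set (plane R)) `&` \bigcup_(i in I) (ball i.1 i.2)).
  apply: measurableI; first exact: measurable_Q.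
  apply: open_measurable_plane; apply: bigcup_open => -[x d] _; exact: (@ball_open R (R * R)%type).
apply/seteqP; split=> x [Qx]; rewrite /= in_itv/=.
  move=> ua; split => //.
  have h : 0 < a - u x by lra.
  have [d d0 hd] := cu Qx h.
  exists (x, d); last by split; rewrite /=; exact: ballxx.
  by move=> y Qy /(hd _ Qy) /=; have := ler_norm (u y - u x); lra.
by move=> [i Ii xi]; split => //; exact: Ii.
Qed.

Lemma measurable_move e (t : R) :
  measurable_fun setT (fun x : plane R => move x e t : plane R).
Proof.
by apply: measurable_fun_pair; apply: measurable_funD => //;
  first [exact: measurable_fst2|exact: measurable_snd2].
Qed.

Let u0 : plane R -> R := u \_ (Q : set (R * R)).

Let mu0 : measurable_fun setT u0.
Proof. by apply/(measurable_restrictT u measurable_Q); exact: measurable_on_Q. Qed.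

Let mu0_move e t : measurable_fun setT (fun x : plane R => u0 (move x e t)).
Proof. exact: (measurableT_comp mu0 (measurable_move e t)). Qed.

Let u0E x : Q x -> u0 x = u x. Proof. by move=> Qx; rewrite /u0 patchE mem_set. Qed.

Lemma measurable_open_square : measurable (@open_square R).
Proof.
rewrite (_ : open_square = `]0, 1[%classic `*` `]0, 1[%classic).
  by apply: measurableX; exact: measurable_itv.
by apply/seteqP; split=> x; rewrite /open_square /= !in_itv/=.
Qed.

Lemma measurable_differentiable_along e : measurable (differentiable_along u e).
Proof.
have mQm t : measurable [set x : plane R | Q (move x e t)].
  by have := measurable_move e t measurableT (@measurable_Q R); rewrite setTI.
rewrite (_ : differentiable_along u e = open_square `&` \bigcap_k \bigcup_n
   ([set x | Q (move x e (recip n))] `&` [set x | Q (move x e (- recip n))] `&`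
    [set x | u0 (move x e (recip n)) + u0 (move x e (- recip n)) <=
        2 * u0 x + recip n * recip k])).
  apply: measurableI; first exact: measurable_open_square.
  apply: bigcapT_measurable => k; apply: bigcupT_measurable => n.
  apply: measurableI; first exact: measurableI.
  apply: measurable_le_set; apply: measurable_funD => //.
  by apply: measurable_funM => //; exact: mu0.
have oQ := @open_square_subQ R.
apply/seteqP; split=> x [ox h]; split => // k.
  move=> _; have [n [Qp Qm hn]] := h k; exists n => //; split => //=.
  by rewrite !u0E//; exact: oQ.
by have [n _ [[Qp Qm] /=]] := h k I; rewrite !u0E//; [exists n|exact: oQ].
Qed.

(* On each line in the direction [e], a rational slope supports [u] strictly at
   one point at most. *)
Lemma leb2_not_differentiable_along e : e = (1, 0) \/ e = (0, 1) ->
  leb2 (open_square `\` differentiable_along u e) = 0%E.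
Proof.
move=> he.
have [e1 e2] : `|e.1| <= 1 /\ `|e.2| <= 1.
  by case: he => ->; rewrite /= normr0 normr1.
have mB : measurable (open_square `\` differentiable_along u e).
  by apply: measurableD; [exact: measurable_open_square|exact: measurable_differentiable_along].
pose supp q x := forall t, t != 0 -> Q (move x e t) -> ratr q * t < u (move x e t) - u x.
have cnt (line : R -> R * R) : (forall s t, line t = move (line s) e (t - s)) ->
    countable [set s | (open_square `\` differentiable_along u e) (line s)].
  move=> hl; pose T q := [set s | Q (line s) /\ supp q (line s)].
  apply: (@sub_countable _ _ _ (\bigcup_(q in [set: rat]) T q)).
    apply: subset_card_le => s [os nd]; have [q hq] := supporting_rat su e1 e2 os nd.
    exists q => //; split => //.
    exact: open_square_subQ os.
  apply: bigcup_countable; first exact: countableP.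
  move=> q _; have [[s Ts]|nT] := pselect (exists s, T q s); last first.
    rewrite (_ : T q = set0); first exact: countable0.
    by rewrite -subset0 => s Ts; apply: nT; exists s.
  rewrite (_ : T q = [set s]); first exact: countable1.
  apply/seteqP; split=> [t Tt|t ->//]; apply: contrapT => /eqP ts.
  move: Ts Tt => [Qs hs] [Qt ht].
  have st : t - s != 0 by rewrite subr_eq0.
  have st' : s - t != 0 by rewrite subr_eq0 eq_sym.
  (* The two strict inequalities, with the same slope and opposite increments, add up to [0 < 0]. *)
  have := hs _ st; rewrite -hl => /(_ Qt).
  have := ht _ st'; rewrite -hl => /(_ Qs).
  by lra.
case: he => eE.
  apply: leb2_ysection0 => // y; apply: countable_lebesgue_measure0.
  rewrite (_ : ysection _ _ = [set s | (open_square `\` differentiable_along u e) (s, y)]).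
    apply: cnt => s t; rewrite eE /move /=; congr pair; ring.
  by apply/seteqP; split=> s; rewrite /ysection/= inE.
apply: leb2_xsection0 => // x; apply: countable_lebesgue_measure0.
rewrite (_ : xsection _ _ = [set s | (open_square `\` differentiable_along u e) (x, s)]).
  apply: cnt => s t; rewrite eE /move /=; congr pair; ring.
by apply/seteqP; split=> s; rewrite /xsection/= inE.
Qed.

Definition smooth_set : set (plane R) :=
  differentiable_along u (1, 0) `&` differentiable_along u (0, 1).

Lemma measurable_smooth_set : measurable smooth_set.
Proof. by apply: measurableI; exact: measurable_differentiable_along. Qed.

Lemma smooth_set_open x : smooth_set x -> open_square x.
Proof. by move=> [[]]. Qed.

Lemma leb2_not_smooth : leb2 ((Q : set (plane R)) `\` smooth_set) = 0%E.
Proof.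
have l1 (b1 b2 : bool) : lebesgue_measure
    [set` Interval (BSide b1 (0 : R)) (BSide b2 1)] = 1%E.
  by rewrite lebesgue_measure_itv/= lte_fin ltr01 -EFinB subr0.
have oE : @open_square R = `]0, 1[%classic `*` `]0, 1[%classic.
  by apply/seteqP; split=> x; rewrite /open_square /= !in_itv/=.
have sub := @open_square_subQ R.
have lQ : leb2 (Q : set (plane R)) = 1%E.
  by rewrite leb2X; [|exact: measurable_itv..]; rewrite !l1 mule1.
have lo : leb2 (@open_square R) = 1%E.
  by rewrite oE leb2X; [|exact: measurable_itv..]; rewrite !l1 mule1.
have mo := measurable_open_square.
have mQ := @measurable_Q R.
have l0 : leb2 ((Q : set (plane R)) `\` open_square) = 0%E.
  rewrite measureD//; last by rewrite [ltLHS]lQ ltry.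
  by rewrite setIidr// [X in (X - _)%E]lQ [X in (_ - X)%E]lo subee.
have m1 := measurable_differentiable_along (1, 0).
have m2 := measurable_differentiable_along (0, 1).
apply/eqP; rewrite eq_le measure_ge0 andbT.
pose N1 := open_square `\` differentiable_along u (1, 0).
pose N2 := open_square `\` differentiable_along u (0, 1).
have mN1 : measurable N1 by exact: measurableD.
have mN2 : measurable N2 by exact: measurableD.
have mN0 : measurable ((Q : set (plane R)) `\` open_square) by exact: measurableD.
apply: (@le_trans _ _ (leb2 (((Q : set (plane R)) `\` open_square) `|` (N1 `|` N2)))).
  apply: le_leb2.
  - by apply: measurableD => //; exact: measurable_smooth_set.
  - by apply: measurableU => //; exact: measurableU.
  - move=> x [Qx ns].
    have [ox|nox] := pselect (open_square x); last by left.
    right; apply: contrapT => /not_orP[n1 n2]; apply: ns; split.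
      by apply: contrapT => h; apply: n1.
    by apply: contrapT => h; apply: n2.
apply: (le_trans (measureU2 _ _ _)) => //; first exact: measurableU.
rewrite [X in (X + _)%E]l0 add0e; apply: (le_trans (measureU2 _ _ _)) => //.
rewrite [X in (X + _)%E]leb2_not_differentiable_along; last by left.
by rewrite [X in (_ + X)%E]leb2_not_differentiable_along ?adde0//; right.
Qed.

Definition slope_along e x : R := xget 0 [set p | line_slope u e x p].

Definition convex_grad x : R * R := (slope_along (1, 0) x, slope_along (0, 1) x).

Lemma slope_alongP e x : `|e.1| <= 1 -> `|e.2| <= 1 -> differentiable_along u e x ->
  line_slope u e x (slope_along e x).
Proof.
move=> e1 e2 dx; have [p hp] := line_slope_ex su e1 e2 dx.1 dx.
exact: (@xgetPex _ 0 [set p | line_slope u e x p] (ex_intro _ p hp)).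
Qed.

Lemma measurable_slope_along e : `|e.1| <= 1 -> `|e.2| <= 1 ->
  measurable_fun (differentiable_along u e) (slope_along e : plane R -> R).
Proof.
move=> e1 e2.
pose h n (x : plane R) : R := (u0 (move x e (recip n)) - u0 x) / recip n.
apply: (@measurable_fun_cvg _ _ _ (differentiable_along u e) h) => [n|x dx].
  apply: measurable_funM => //; apply: measurable_funTS.
  by apply: measurable_funB => //; exact: mu0.
have [s1 s2] := slope_alongP e1 e2 dx.
apply/cvgrPdist_le => eps eps0.
have [d d0 hd] := s2 _ eps0.
have [m [m0 hm]] : exists m, True /\ recip m < d by have [m ?] := recip_lt d0; exists m.
near=> n.
have nm : recip n <= recip m :> R.
  by rewrite lef_pV2 ?posrE// ler_nat ltnS; near: n; exact: nbhs_infty_ge.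
have n0 := recip_gt0 (R := R) n.
have [|Qn hn] := hd (recip n); first by rewrite gtr0_norm//; lra.
have := s1 _ Qn => hn'.
rewrite gtr0_norm// in hn.
have Qx : Q x by exact: open_square_subQ dx.1.
rewrite /h !u0E// distrC ler_distl; apply/andP; split.
  by rewrite ler_pdivlMr//; nra.
by rewrite ler_pdivrMr//; lra.
Unshelve. all: by end_near. Qed.

End ConvexGradient.

(** * Continuity of the gradient and its left inverse *)

Section ConvexGradientProperties.
Context {R : realType} (u : R * R -> R).
Hypothesis cu : forall x, Q x -> forall eps : R, 0 < eps -> exists2 d : R, 0 < d &
  forall y, Q y -> ball x d y -> `|u y - u x| < eps.
Hypothesis su : strictly_convex u.
Implicit Types (x y e p : R * R) (t : R).

Let S := smooth_set u.
Let P := convex_grad u.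

Let SQ x : S x -> Q x.
Proof. by move=> /smooth_set_open; exact: open_square_subQ. Qed.

Let slope1 x : S x -> line_slope u (1, 0) x (P x).1.
Proof. by move=> [d1 _]; apply: slope_alongP => //=; rewrite ?normr1 ?normr0. Qed.

Let slope2 x : S x -> line_slope u (0, 1) x (P x).2.
Proof. by move=> [_ d2]; apply: slope_alongP => //=; rewrite ?normr1 ?normr0. Qed.

(** The point [y] is the midpoint of two points on the coordinate lines through [x], with increments
    [2 * v1] and [2 * v2], so convexity gives the upper bound. The lower bound is the upper one at
    the reflected point [z], because [x] is the midpoint of [y] and [z]. *)
Lemma convex_grad_differentiable x : S x -> forall eps : R, 0 < eps ->
  exists2 d : R, 0 < d & forall y, dist1 x y <= d ->
    Q y /\ `|u y - u x - lin (P x) x y| <= eps * dist1 x y.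
Proof.
move=> Sx eps eps0.
have [_ /(_ _ eps0)[h1 h10 H1]] := slope1 Sx.
have [_ /(_ _ eps0)[h2 h20 H2]] := slope2 Sx.
have d0 : 0 < Num.min h1 h2 / 2 by rewrite divr_gt0// lt_min h10.
have upper y : dist1 x y <= Num.min h1 h2 / 2 ->
    Q y /\ u y - u x - lin (P x) x y <= eps * dist1 x y.
  set v1 := y.1 - x.1; set v2 := y.2 - x.2.
  rewrite ler_pdivlMr// le_min => /andP[m1 m2].
  have n1 := normr_ge0 v1; have n2 := normr_ge0 v2.
  rewrite /dist1 -/v1 -/v2 in m1 m2.
  have [|Q1 U1] := H1 (2 * v1); first by rewrite normrM gtr0_norm//; lra.
  have [|Q2 U2] := H2 (2 * v2); first by rewrite normrM gtr0_norm//; lra.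
  have h : 0 <= (1 / 2 : R) <= 1 by apply/andP; split; lra.
  have yE : y = (1 / 2 * (move x (1, 0) (2 * v1)).1 + (1 - 1 / 2) * (move x (0, 1) (2 * v2)).1,
     1 / 2 * (move x (1, 0) (2 * v1)).2 + (1 - 1 / 2) * (move x (0, 1) (2 * v2)).2).
    by rewrite [LHS]surjective_pairing /move /v1 /v2 /=; congr pair; field.
  split; first by rewrite yE; exact: Q_convex.
  have := convex_le su Q1 Q2 h; rewrite -yE.
  move: U1 U2; rewrite !normrM gtr0_norm// /lin /dist1 -/v1 -/v2 => U1 U2 U.
  by lra.
exists (Num.min h1 h2 / 2) => // y dy.
have [Qy Uy] := upper _ dy; split => //.
pose z : R * R := (2 * x.1 - y.1, 2 * x.2 - y.2).
have ez1 : z.1 - x.1 = - (y.1 - x.1) by rewrite /z /=; ring.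
have ez2 : z.2 - x.2 = - (y.2 - x.2) by rewrite /z /=; ring.
have dz : dist1 x z = dist1 x y by rewrite /dist1 ez1 ez2 !normrN.
have lz : lin (P x) x z = - lin (P x) x y by rewrite /lin ez1 ez2; ring.
have [|Qz] := upper z; rewrite dz// lz => Uz.
have h : 0 <= (1 / 2 : R) <= 1 by apply/andP; split; lra.
have xE : x = (1 / 2 * y.1 + (1 - 1 / 2) * z.1, 1 / 2 * y.2 + (1 - 1 / 2) * z.2).
  by rewrite [LHS]surjective_pairing /z /=; congr pair; field.
have := convex_le su Qy Qz h; rewrite -xE => Um.
by rewrite ler_norml; apply/andP; split; lra.
Qed.

(** If [u y] fell below the tangent plane, convexity would carry the defect, in proportion, to
    points of the segment close to [x], against differentiability with [eps] half the relative
    defect. *)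
Lemma convex_grad_subgradient x y : S x -> Q y -> u x + lin (P x) x y <= u y.
Proof.
move=> Sx Qy; rewrite leNgt; apply/negP => h.
have [xy|xy] := ltP 0 (dist1 x y); last first.
  by move: h; rewrite (dist1_eq0 xy) /lin !subrr !mulr0 !addr0 ltxx.
pose eps := (u x + lin (P x) x y - u y) / (2 * dist1 x y).
have eps0 : 0 < eps by rewrite divr_gt0 ?mulr_gt0//; lra.
have [d d0 hd] := convex_grad_differentiable Sx eps0.
pose t := Num.min 1 (d / dist1 x y).
have t0 : 0 < t by rewrite lt_min ltr01 divr_gt0.
have t1 : 0 <= t <= 1 by rewrite ltW// ge_min lexx.
pose z : R * R := (t * y.1 + (1 - t) * x.1, t * y.2 + (1 - t) * x.2).
have ez1 : z.1 - x.1 = t * (y.1 - x.1) by rewrite /z /=; ring.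
have ez2 : z.2 - x.2 = t * (y.2 - x.2) by rewrite /z /=; ring.
have dz : dist1 x z = t * dist1 x y.
  by rewrite /dist1 ez1 ez2 !normrM gtr0_norm//; ring.
have lz : lin (P x) x z = t * lin (P x) x y by rewrite /lin ez1 ez2; ring.
have [|Qz] := hd z; first by rewrite dz -ler_pdivlMr// ge_min lexx orbT.
rewrite dz lz ler_norml => /andP[h1 _].
have h2 := convex_le su Qy (SQ Sx) t1; rewrite -/z in h2.
have h3 : eps * (t * dist1 x y) = t * ((u x + lin (P x) x y - u y) / 2).
  by rewrite /eps; field; rewrite gt_eqF.
rewrite h3 in h1.
have : 0 < t * (u x + lin (P x) x y - u y) by rewrite mulr_gt0//; lra.
by nra.
Qed.

(** For one fixed step [h], the slope at [y] lies between the backward and forward quotients at [y].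
    These are close to the quotients at [x] by continuity of [u], and the latter are within
    [eps / 4] of the slope at [x]. *)
Lemma convex_grad_continuous_along e x : S x -> (e = (1, 0) \/ e = (0, 1)) ->
  forall eps : R, 0 < eps -> exists2 d : R, 0 < d &
  forall y, S y -> ball x d y -> `|slope_along u e y - slope_along u e x| < eps.
Proof.
move=> Sx he eps eps0.
have sl z : S z -> line_slope u e z (slope_along u e z).
  by case: he => ->; [exact: slope1|exact: slope2].
have e1 : `|e.1| <= 1 /\ `|e.2| <= 1 by case: he => ->; rewrite /= normr0 normr1.
have eps40 : 0 < eps / 4 by lra.
have [_ /(_ _ eps40)[h0 h00 H]] := sl _ Sx.
(* This supplies a radius [dd] around [x] that stays in [Q]: [y] is within [dd / 2] of [x] in
   [dist1], and the step is at most [dd / 2]. *)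
have [dd dd0 Hd] := convex_grad_differentiable Sx ltr01.
pose h := Num.min h0 (dd / 2).
have hp : 0 < h by rewrite lt_min h00 divr_gt0.
have hh0 : h <= h0 by rewrite ge_min lexx.
have hhd : h <= dd / 2 by rewrite ge_min lexx orbT.
have [|Qp Up] := H h; first by rewrite gtr0_norm.
have [|Qm Um] := H (- h); first by rewrite normrN gtr0_norm.
have eh0 : 0 < eps / 4 * h by rewrite mulr_gt0.
have [d1 d10 D1] := cu Qp eh0.
have [d2 d20 D2] := cu Qm eh0.
have [d3 d30 D3] := cu (SQ Sx) eh0.
exists (Num.min (Num.min d1 d2) (Num.min d3 (dd / 4))).
  by rewrite !lt_min d10 d20 d30 divr_gt0.
move=> y Sy xy.
have b1 : ball x d1 y by apply: le_ball xy; rewrite !ge_min lexx.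
have b2 : ball x d2 y by apply: le_ball xy; rewrite !ge_min lexx orbT.
have b3 : ball x d3 y by apply: le_ball xy; rewrite !ge_min lexx !orbT.
have b4 : ball x (dd / 4) y by apply: le_ball xy; rewrite !ge_min lexx !orbT.
have bmove (r t : R) : ball x r y -> ball (move x e t) r (move y e t).
  move=> [/=]; rewrite /ball/= => g1 g2; split; rewrite /ball/= /move/=.
    by rewrite (_ : _ - _ = x.1 - y.1)//; ring.
  by rewrite (_ : _ - _ = x.2 - y.2)//; ring.
have Qmove (t : R) : `|t| <= h -> Q (move y e t).
  move=> th; have [] := Hd (move y e t); last by [].
  have dxy := dist1_ball b4.
  have : dist1 y (move y e t) <= `|t|.
    have E (a b : R) : a + b - a = b by ring.
    rewrite /dist1 /move /= !E !normrM.
    by case: he => -> /=; rewrite normr0 normr1 mulr0 mulr1 ?addr0 ?add0r.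
  have := ler_distD y.1 (move y e t).1 x.1; have := ler_distD y.2 (move y e t).2 x.2.
  by rewrite /dist1 in dxy *; lra.
have Qyp : Q (move y e h) by apply: Qmove; rewrite gtr0_norm.
have Qym : Q (move y e (- h)) by apply: Qmove; rewrite normrN gtr0_norm.
have [sy _] := sl _ Sy.
have := sy _ Qyp; have := sy _ Qym.
have := D1 _ Qyp (bmove _ _ b1); have := D2 _ Qym (bmove _ _ b2); have := D3 _ (SQ Sy) b3.
rewrite !ltr_norml => /andP[? ?] /andP[? ?] /andP[? ?] ? ?.
move: Up Um; rewrite normrN gtr0_norm// => ? ?.
by apply/andP; split; rewrite -(ltr_pM2r hp); nra.
Qed.

Let supporting p x := Q x /\ forall y, Q y ->
  u x - (p.1 * x.1 + p.2 * x.2) <= u y - (p.1 * y.1 + p.2 * y.2).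

(** This is the gradient of the convex conjugate of [u] on [Q]. By compactness and strict convexity
    the minimum point exists and is unique for every [p], so the left inverse of the gradient is
    defined on the whole plane. *)
Definition argmin p : R * R := xget (0, 0) [set x | supporting p x].

Lemma supporting_unique p x y : supporting p x -> supporting p y -> x = y.
Proof.
move=> [Qx hx] [Qy hy]; apply: contrapT => xy.
have h : 0 < (1 / 2 : R) < 1 by apply/andP; split; lra.
have h' : 0 <= (1 / 2 : R) <= 1 by apply/andP; split; lra.
have := hx _ (Q_convex Qx Qy h'); have := su Qx Qy xy h.
have := hy _ Qx; have := hx _ Qy; rewrite /=.
by lra.
Qed.

Let continuous_on_Q : {within (Q : set (R * R)), continuous u}.
Proof.
apply/subspace_continuousP => x Qx; apply/cvgrPdist_lt => eps eps0.
have [d d0 hd] := cu Qx eps0.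
rewrite near_withinE; near=> y => Qy; rewrite distrC; apply: hd => //.
by near: y; exact: nbhsx_ballx.
Unshelve. all: by end_near. Qed.

Let compact_Q : compact (Q : set (R * R)).
Proof. by apply: compact_setX; exact: segment_compact. Qed.

Let affine_min (p : R * R) (K : set (R * R)) : compact K -> K `<=` Q -> K !=set0 ->
  exists2 x, K x & forall y, K y ->
    u x - (p.1 * x.1 + p.2 * x.2) <= u y - (p.1 * y.1 + p.2 * y.2).
Proof.
move=> cK KQ K0.
have lc : continuous (fun y : R * R => p.1 * y.1 + p.2 * y.2).
  move=> y; apply: (@cvgD _ _ _ _ _ (fun y : R * R => p.1 * y.1) (fun y : R * R => p.2 * y.2)).
    by apply: cvgM; [exact: cvg_cst|exact: cvg_fst].
  by apply: cvgM; [exact: cvg_cst|exact: cvg_snd].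
have fc : {within K, continuous (fun y : R * R => u y - (p.1 * y.1 + p.2 * y.2))}.
  have /subspace_continuousP uK := continuous_subspaceW KQ continuous_on_Q.
  apply/subspace_continuousP => y Ky; apply: cvgB; first exact: uK.
  by apply: cvg_within_filter; exact: lc.
have [x xK hx] := compact_EVT_min K0 cK fc.
exists x; first by rewrite inE in xK.
by move=> y Ky; apply: hx; rewrite inE.
Qed.

Lemma argminP p : supporting p (argmin p).
Proof.
have [x Qx hx] : exists2 x, Q x & forall y, Q y ->
    u x - (p.1 * x.1 + p.2 * x.2) <= u y - (p.1 * y.1 + p.2 * y.2).
  apply: affine_min => //.
  by exists (0, 0); split; rewrite /= in_itv/= lexx ler01.
by apply: (@xgetPex _ _ [set x | supporting p x]); exists x; split.
Qed.

Lemma argmin_grad x : S x -> argmin (P x) = x.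
Proof.
move=> Sx; apply: (supporting_unique (argminP _)); split; first exact: SQ.
by move=> y Qy; have := convex_grad_subgradient Sx Qy; rewrite /lin; lra.
Qed.

(** On the compact set [K] of points with [a <= pr x] the minimum exceeds the minimum over [Q] by
    some [g > 0], by uniqueness. Moving each coordinate of [p] by less than [g / 4] changes
    differences of values on [Q] by at most [g / 2], the sides of [Q] having length 1, so the
    minimum point stays out of [K]. *)
Let open_argmin (pr : R * R -> R) (a : R) : continuous pr ->
  open [set p | pr (argmin p) < a].
Proof.
move=> cpr; rewrite openE => p /= pa; have [Q0 h0] := argminP p.
pose K := Q `&` [set x | a <= pr x].
have cK : compact K.
  apply: compact_closedI => //.
  rewrite (_ : [set x | a <= pr x] = pr @^-1` `[a, +oo[).
    by apply: closed_comp => [x _|]; [exact: cpr|exact: interval_closed].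
  by apply/seteqP; split=> x /=; rewrite in_itv/= andbT.
apply/nbhs_ballP.
have [K0|nK] := pselect (K !=set0); last first.
  exists 1 => //= q _; rewrite /= ltNge; apply/negP => h; apply: nK.
  by exists (argmin q); split => //; have [] := argminP q.
have [y [Qy ay] hy] := @affine_min p K cK (@subIsetl _ _ _) K0.
pose g := (u y - (p.1 * y.1 + p.2 * y.2)) -
  (u (argmin p) - (p.1 * (argmin p).1 + p.2 * (argmin p).2)).
have g0 : 0 < g.
  rewrite subr_gt0 lt_neqAle h0// andbT; apply/eqP => e.
  have : supporting p y by split => // z Qz; rewrite -e; exact: h0.
  by move=> /(supporting_unique (argminP p)) e'; move: pa; rewrite e' ltNge ay.
exists (g / 4) => /=; first by rewrite divr_gt0.
move=> q [/= q1 q2]; rewrite /= ltNge; apply/negP => h.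
have [Qz hz] := argminP q.
have Kz : K (argmin q) by split.
have k1 := hy _ Kz; have k2 := hz _ Q0.
have bnd (s t r : R) : `|s - t| < g / 4 -> `|r| <= 1 -> `|(s - t) * r| <= g / 4.
  by move=> h1 h2; rewrite normrM; have := normr_ge0 (s - t); have := normr_ge0 r; nra.
have Q1 (z w : R * R) : Q z -> Q w -> `|z.1 - w.1| <= 1 /\ `|z.2 - w.2| <= 1.
  move=> [/=]; rewrite !in_itv/= => /andP[? ?] /andP[? ?] [/=]; rewrite !in_itv/=.
  by move=> /andP[? ?] /andP[? ?]; rewrite !ler_norml; split; apply/andP; split; lra.
have [z1 z2] := Q1 _ _ Qz Q0.
have := bnd _ _ _ q1 z1; have := bnd _ _ _ q2 z2.
rewrite !ler_norml => /andP[b1 b2] /andP[b3 b4].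
have : g = (u y - (p.1 * y.1 + p.2 * y.2)) -
  (u (argmin p) - (p.1 * (argmin p).1 + p.2 * (argmin p).2)) by [].
have := g0; clear -k1 k2 b1 b2 b3 b4; move: g b1 b2 b3 b4 => g b1 b2 b3 b4 ? ?; lra.
Qed.

Lemma measurable_argmin : measurable_fun setT (argmin : plane R -> plane R).
Proof.
have main (pr : R * R -> R) : continuous pr ->
    measurable_fun setT (fun p : plane R => pr (argmin p)).
  move=> cpr mT; apply: (measurability _ (@RGenInftyO.measurableE R)) => //.
  move=> _ [_ [a ->] <-]; apply: measurableI => //.
  apply: open_measurable_plane.
  rewrite (_ : _ @^-1` _ = [set p | pr (argmin p) < a]); first exact: open_argmin.
  by apply/seteqP; split=> p /=; rewrite in_itv.
have m1 : measurable_fun setT (fun p : plane R => (argmin p).1).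
  by apply: (main fst) => x; exact: cvg_fst.
have m2 : measurable_fun setT (fun p : plane R => (argmin p).2).
  by apply: (main snd) => x; exact: cvg_snd.
have := measurable_fun_pair m1 m2.
congr (measurable_fun _ _); apply/funext => p.
by rewrite [RHS]surjective_pairing.
Qed.
End ConvexGradientProperties.

(** * The Gauss map *)

Lemma ord3_cases (i : 'I_3) : i = 0 \/ i = 1 \/ i = 2.
Proof. by case: i => [[|[|[|//]]] ?]; [left|right; left|right; right]; exact: val_inj. Qed.

Section GaussMap.
Context {R : realType}.
Implicit Types (p q : R * R) (i j k l : 'I_3).

Lemma continuous_measurable_plane (f : R * R -> R) : continuous f ->
  measurable_fun setT (f : plane R -> R).
Proof.
move=> /continuousP cf mT; apply: (measurability _ (@RGenInftyO.measurableE R)) => //.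
move=> _ [_ [a ->] <-]; apply: measurableI => //.
by apply: open_measurable_plane; apply: cf; exact: interval_open.
Qed.

Definition gauss i p : R :=
  (Num.sqrt (1 + (p.1 ^+ 2 + p.2 ^+ 2)))^-1 * [:: - p.1; - p.2; 1]`_i.

Let rad_gt0 p : 0 < Num.sqrt (1 + (p.1 ^+ 2 + p.2 ^+ 2)).
Proof. by rewrite sqrtr_gt0 ltr_pwDl// addr_ge0// sqr_ge0. Qed.

Lemma continuous_gauss i : continuous (gauss i).
Proof.
move=> p; apply: cvgM.
  apply: cvgV; first by rewrite gt_eqF.
  apply: (@cvg_comp _ _ _ (fun p : R * R => 1 + (p.1 ^+ 2 + p.2 ^+ 2)) (@Num.sqrt R));
    last exact: sqrt_continuous.
  apply: cvgD; first exact: cvg_cst.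
  apply: cvgD; rewrite expr2.
    by under eq_fun do rewrite expr2; apply: cvgM; exact: cvg_fst.
  by under eq_fun do rewrite expr2; apply: cvgM; exact: cvg_snd.
case: i => [[|[|[|//]]] ?] /=.
- by apply: cvgN; exact: cvg_fst.
- by apply: cvgN; exact: cvg_snd.
- exact: cvg_cst.
Qed.

Lemma gauss_sqr p : gauss 0 p ^+ 2 + gauss 1 p ^+ 2 + gauss 2 p ^+ 2 = 1.
Proof.
rewrite /gauss /= !exprMn -!mulrDr exprVn sqr_sqrtr; last first.
  by rewrite !addr_ge0// sqr_ge0.
have h : 1 + (p.1 ^+ 2 + p.2 ^+ 2) != 0.
  by rewrite gt_eqF// ltr_pwDl// addr_ge0// sqr_ge0.
by field.
Qed.

Lemma gauss_le1 i p : `|gauss i p| <= 1.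
Proof.
rewrite -(@ler_pXn2r _ 2)// ?nnegrE// expr1n real_normK ?num_real//.
have := gauss_sqr p.
have := sqr_ge0 (gauss 0 p); have := sqr_ge0 (gauss 1 p); have := sqr_ge0 (gauss 2 p).
by have [->|[->|->]] := ord3_cases i; lra.
Qed.

(* A point of the sphere is determined by two of its coordinates and the sign
   of the third one. *)
Definition complete (s : R) i j (q : R * R) l : R :=
  if l == i then q.1 else if l == j then q.2 else s * Num.sqrt (1 - q.1 ^+ 2 - q.2 ^+ 2).

(** The gradient is recovered as minus the first two components of the normal over the third. The
    reciprocal is written as a real power, a measurable function that agrees with the inverse on
    nonnegative numbers. *)
Definition ungauss (s : R) i j (q : R * R) : R * R :=
  (- complete s i j q 0 * (complete s i j q 2 `^ (-1)),
   - complete s i j q 1 * (complete s i j q 2 `^ (-1))).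

Lemma measurable_ungauss s i j :
  measurable_fun setT (ungauss s i j : plane R -> plane R).
Proof.
have mc l : measurable_fun setT (fun q : plane R => complete s i j q l).
  rewrite /complete; case: (l == i); first exact: measurable_fst2.
  case: (l == j); first exact: measurable_snd2.
  apply: measurable_funM => //.
  suff h : measurable_fun setT (fun q : plane R => 1 - q.1 ^+ 2 - q.2 ^+ 2 : R).
    exact: (measurableT_comp (@measurable_sqrt R) h).
  apply: measurable_funB; last by apply: measurable_funX; exact: measurable_snd2.
  by apply: measurable_funB => //; apply: measurable_funX; exact: measurable_fst2.
have mp : measurable_fun setT (fun q : plane R => complete s i j q 2 `^ (-1)).
  exact: (measurableT_comp (measurable_powR _) (mc 2)).
apply: measurable_fun_pair; apply: measurable_funM => //;
  by apply: measurableT_comp.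
Qed.

Lemma complete_gauss s i j l p : i != j ->
    (s = 1 \/ s = -1) -> (forall k, k != i -> k != j -> 0 <= s * gauss k p) ->
  complete s i j (gauss i p, gauss j p) l = gauss l p.
Proof.
move=> ij hs sg; rewrite /complete /=; case: eqVneq => [->//|li]; case: eqVneq => [->//|lj].
have -> : 1 - gauss i p ^+ 2 - gauss j p ^+ 2 = gauss l p ^+ 2.
  rewrite -(gauss_sqr p).
  move: ij li lj; case: (ord3_cases i) => [->|[->|->]]; case: (ord3_cases j) => [->|[->|->]];
    case: (ord3_cases l) => [->|[->|->]] => //= _ _ _; ring.
rewrite sqrtr_sqr; have := sg l li lj.
case: hs => ->; rewrite ?mul1r ?mulN1r.
  by move=> h; rewrite ger0_norm.
by rewrite oppr_ge0 => h; rewrite ler0_norm// opprK.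
Qed.

Lemma ungauss_gauss s i j p : i != j ->
    (s = 1 \/ s = -1) -> (forall k, k != i -> k != j -> 0 <= s * gauss k p) ->
  ungauss s i j (gauss i p, gauss j p) = p.
Proof.
move=> ij hs sg; rewrite /ungauss !complete_gauss// powR_inv1; last first.
  by rewrite /gauss /= mulr1 invr_ge0 ltW.
have r0 := rad_gt0 p; rewrite [RHS]surjective_pairing /gauss /=.
by congr pair; field; rewrite gt_eqF.
Qed.

End GaussMap.

(** * Minors for an abstract gradient [P] with left inverse [X] *)

Section Minors.
Context {R : realType} (u : R * R -> R) (S : set (plane R)) (P X : R * R -> R * R).
Hypothesis mS : measurable S.
Hypothesis Sint : S `<=` open_square.
Hypothesis nullS : leb2 ((Q : set (plane R)) `\` S) = 0%E.
Hypothesis mu : measurable_fun S (u : plane R -> R).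
Hypothesis cu : forall x, S x -> forall e : R, 0 < e -> exists2 d : R, 0 < d &
  forall y, S y -> ball x d y -> `|u y - u x| < e.
Hypothesis mP : measurable_fun S (P : plane R -> plane R).
Hypothesis cP : forall x, S x -> forall e : R, 0 < e -> exists2 d : R, 0 < d &
  forall y, S y -> ball x d y -> ball (P x) e (P y).
Hypothesis dP : forall x, S x -> forall eps : R, 0 < eps -> exists2 d : R, 0 < d &
  forall y, dist1 x y <= d -> `|u y - u x - lin (P x) x y| <= eps * dist1 x y.
Hypothesis mX : measurable_fun setT (X : plane R -> plane R).
Hypothesis XP : forall x, S x -> X (P x) = x.

Let SQ : S `<=` (Q : set (plane R)) := subset_trans Sint (@open_square_subQ R).

Let ap_grad_u x : S x -> ap_grad u x 0 0 = (P x).1 /\ ap_grad u x 0 1 = (P x).2.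
Proof.
move=> Sx; pose L : 'rV[R]_2 := \row_(j < 2) [:: (P x).1; (P x).2]`_j.
have LP : slope L = P x by rewrite /slope !mxE -surjective_pairing.
have dL : ap_differential u x L.
  apply/(ap_differentialP mS SQ nullS (open_of_inner Sint) mu cu _ Sx) => c k c0 k0.
  (* Differentiability in the classical sense with constant [c / 2] contradicts the inequality in
     [bad], whose trace on small balls is therefore empty. *)
  have c20 : 0 < c / 2 by lra.
  have [d d0 hd] := dP Sx c20.
  have [m hm] := half_lt (divr_gt0 d0 (ltr0n R 2)).
  exists m => n mn; rewrite (_ : _ `&` _ = set0).
    by rewrite measure0 lee_fin mulr_ge0// ltW// exprn_gt0// half_gt0.
  rewrite -subset0 => y [[Sy dy]] + /dist1_ball xy; rewrite LP.
  have := half_le (R := R) mn => hmn.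
  have /hd : dist1 x y <= d by lra.
  by move=> h1 /le_trans/(_ h1); rewrite ler_pM2r//; lra.
rewrite (ap_gradE mS SQ nullS (open_of_inner Sint) mu cu Sx dL).
by rewrite -[(P x)]LP.
Qed.

Lemma unit_normalE x i : S x -> unit_normal u x 0 i = gauss i (P x).
Proof.
move=> Sx; have [e1 e2] := ap_grad_u Sx.
rewrite /unit_normal /gauss !mxE -e1 -e2; congr ((Num.sqrt (1 + _))^-1 * _).
rewrite /normv sqr_sqrtr /dotv; last by apply: sumr_ge0 => j _; rewrite -expr2 sqr_ge0.
rewrite big_ord_recl big_ord1 -!expr2; congr (_ + ap_grad u x 0 _ ^+ 2).
exact: val_inj.
Qed.

Let f i := fun y => unit_normal u y 0 i.

Let mf i : measurable_fun S (f i : plane R -> R).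
Proof.
apply: (@eq_measurable_fun _ _ (plane R) R S (fun x => gauss i (P x))) => [x|].
  by rewrite inE /f => Sx; rewrite unit_normalE.
exact: (measurableT_comp (continuous_measurable_plane (continuous_gauss (i := i))) mP).
Qed.

Let cf i x : S x -> forall e : R, 0 < e -> exists2 d : R, 0 < d &
  forall y, S y -> ball x d y -> `|f i y - f i x| < e.
Proof.
move=> Sx e e0.
have /cvgrPdist_lt/(_ _ e0)/nbhs_ballP[d /= d0 hd] := @continuous_gauss R i (P x).
have [d' d'0 hd'] := cP Sx d0.
exists d' => [|y Sy xy]; first exact: d'0.
have key (a b a' b' : R) : a = a' -> b = b' -> `|a' - b'| < e -> `|b - a| < e.
  by move=> -> ->; rewrite distrC.
exact: (key _ _ _ _ (unit_normalE i Sx) (unit_normalE i Sy) (hd _ (hd' _ Sy xy))).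
Qed.

Let minor_integrable i j : i != j -> (\int[leb2]_(x in S) `|jac2 (f i) (f j) x|%:E < +oo)%E.
Proof.
move=> ij.
(* Where the remaining component keeps the sign [s], [ungauss] turns the two components into the
   gradient and [X] turns the gradient into the point; the composition is the Borel left inverse. *)
have main s (E : set (plane R)) : measurable E -> E `<=` S -> (s = 1 \/ s = -1) ->
    (forall x k, E x -> k != i -> k != j -> 0 <= s * gauss k (P x)) ->
    (\int[leb2]_(x in E) `|jac2 (f i) (f j) x|%:E < +oo)%E.
  move=> mE ES hs hE.
  apply: (@jac2_integrable _ S mS Sint nullS (f i) (f j) (mf i) (mf j) (@cf i) (@cf j)
    E (fun q => X (ungauss s i j q)) mE ES).
  - exact: (measurableT_comp mX (measurable_ungauss s i j)).
  - by move=> x /ES Sx; split; [have := gauss_le1 i (P x)|have := gauss_le1 j (P x)];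
      rewrite -unit_normalE.
  - move=> x Ex; have Sx := ES _ Ex.
    have key (a b a' b' : R) : a = a' -> b = b' -> X (ungauss s i j (a', b')) = x ->
       X (ungauss s i j (a, b)) = x by move=> -> ->.
    apply: (key _ _ _ _ (unit_normalE i Sx) (unit_normalE j Sx)).
    rewrite ungauss_gauss; [exact: XP|exact: ij|exact: hs|].
    by move=> k; exact: hE.
have [k0 hk0] : exists k0 : 'I_3, forall k, k != i -> k != j -> k = k0.
  have [h0|h0] := boolP ((0 != i) && (0 != j)).
    exists 0 => k ki kj; move/andP: h0 => []; move: ij ki kj.
    by case: (ord3_cases i) => [->|[->|->]]; case: (ord3_cases j) => [->|[->|->]]; case: (ord3_cases k) => [->|[->|->]].
  have [h1|h1] := boolP ((1 != i) && (1 != j)).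
    exists 1 => k ki kj; move/andP: h1 => []; move: ij ki kj.
    by case: (ord3_cases i) => [->|[->|->]]; case: (ord3_cases j) => [->|[->|->]]; case: (ord3_cases k) => [->|[->|->]].
  exists 2 => k ki kj; move: h0 h1 ij ki kj.
  by case: (ord3_cases i) => [->|[->|->]]; case: (ord3_cases j) => [->|[->|->]]; case: (ord3_cases k) => [->|[->|->]].
pose E1 := S `&` [set x | 0 <= ((fun x => gauss k0 (P x)) \_ S) x].
have mg : measurable_fun S (fun x : plane R => gauss k0 (P x)).
  exact: (measurableT_comp (continuous_measurable_plane (continuous_gauss (i := k0))) mP).
have mE1 : measurable E1.
  apply: measurableI => //; apply: (measurable_le_set (measurable_cst _)).
  exact/(measurable_restrictT _ mS).
have E1S : E1 `<=` S by exact: subIsetl.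
have mE2 : measurable (S `\` E1) by exact: measurableD.
have i1 : (\int[leb2]_(x in E1) `|jac2 (f i) (f j) x|%:E < +oo)%E.
  apply: (main 1) => //; first by left.
  move=> x k [Sx h] ki kj; rewrite (hk0 _ ki kj) mul1r.
  by move: h; rewrite /= patchE mem_set.
have i2 : (\int[leb2]_(x in S `\` E1) `|jac2 (f i) (f j) x|%:E < +oo)%E.
  apply: (main (-1)); [exact: mE2|by move=> x []|by right|].
  move=> x k [Sx h] ki kj; rewrite (hk0 _ ki kj) mulN1r oppr_ge0 leNgt; apply/negP => g0.
  by apply: h; split => //=; rewrite patchE mem_set// ltW.
have mj : measurable_fun S (fun x : plane R => `|jac2 (f i) (f j) x|%:E).
  apply/measurable_EFinP; apply: measurableT_comp => //.
  exact: (measurable_jac2 mS Sint nullS (mf i) (mf j) (@cf i) (@cf j)).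
have -> : (\int[leb2]_(x in S) `|jac2 (f i) (f j) x|%:E =
    \int[leb2]_(x in E1) `|jac2 (f i) (f j) x|%:E +
    \int[leb2]_(x in S `\` E1) `|jac2 (f i) (f j) x|%:E)%E.
  rewrite -{1}(setDUK E1S) ge0_integral_setU//=.
  - by rewrite setDUK.
  - by rewrite disj_set2E setDIK.
by rewrite lte_add_pinfty.
Qed.

Lemma minor_L1Q i j : i != j -> L1Q (jac2 (f i) (f j)).
Proof.
move=> ij.
have mj := measurable_jac2 mS Sint nullS (mf i) (mf j) (@cf i) (@cf j).
exists (jac2 (f i) (f j) \_ S).
  have mR : measurable_fun setT (jac2 (f i) (f j) \_ S : plane R -> R).
    exact/(measurable_restrictT _ mS).
  apply/integrableP; split; first by apply/measurable_EFinP; exact: measurable_funTS.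
  apply: le_lt_trans (minor_integrable ij).
  rewrite [leRHS]integral_mkcond [leLHS]integral_mkcond.
  rewrite le_eqVlt; apply/orP; left; apply/eqP; apply: eq_integral => x _.
  rewrite !patchE; case: (boolP (x \in S)) => [xS|xS].
    have -> : x \in Q by rewrite inE; apply: SQ; rewrite inE in xS.
    by rewrite /= patchE xS.
  by case: ifP => // _; rewrite /= patchE (negbTE xS) normr0.
exists ((Q : set (plane R)) `\` S); split.
- by apply: measurableD => //; exact: measurable_Q.
- exact: nullS.
- move=> x /= /not_implyP[Qx h]; split => // Sx; apply: h.
  by rewrite patchE mem_set.
Qed.

Lemma normal_minor_L1Q (r : 'I_2 -> 'I_3) (c : 'I_2 -> 'I_2) :
  {homo r : i j / (i < j)%N} -> {homo c : i j / (i < j)%N} ->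
  L1Q (fun x => \det (mxsub r c (normal_jacobian u x))).
Proof.
move=> hr hc.
have c01 : c 0 = 0 /\ c 1 = 1.
  have := hc 0 1 isT; have := ltn_ord (c 1).
  by case: (c 0) (c 1) => [[|[|//]] ?] [[|[|//]] ?] //= _ _; split; exact: val_inj.
have r01 : r 0 != r 1 by apply/eqP => e; have := hr 0 1 isT; rewrite e ltnn.
rewrite (_ : (fun x => _) = jac2 (f (r 0)) (f (r 1))); first exact: minor_L1Q.
apply/funext => x; rewrite (expand_det_row _ 0) big_ord_recl big_ord1.
rewrite /cofactor !det_mx11 !mxE /jac2 /f.
have -> : lift ord0 ord0 = 1 :> 'I_2 by exact: val_inj.
have -> : lift (1 : 'I_2) (0 : 'I_1) = 0 :> 'I_2 by exact: val_inj.
rewrite c01.1 c01.2 /=; ring.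
Qed.

End Minors.

(** * Convex and concave functions together *)

Section StrictlyConvex.
Context {R : realType} (u : R * R -> R).
Hypothesis cu : {within (Q : set (R * R)), continuous u}.
Implicit Types (x y : R * R).

Lemma within_continuous_dist x : Q x -> forall eps : R, 0 < eps -> exists2 d : R, 0 < d &
  forall y, Q y -> ball x d y -> `|u y - u x| < eps.
Proof.
move=> Qx eps eps0.
have /subspace_continuousP/(_ _ Qx)/cvgrPdist_lt/(_ _ eps0) := cu.
rewrite near_withinE => /nbhs_ballP[d /= d0 hd].
by exists d => // y Qy /hd/(_ Qy); rewrite distrC.
Qed.

(** With [s] equal to 1 or -1, the gradient of [u] is [s] times that of the strictly convex [v]. The
    map [scale] is its own inverse, so [argmin v] after [scale] is a left inverse of the gradient of
    [u]. *)
Lemma strictly_convex_minor_L1Q (s : R) (r : 'I_2 -> 'I_3) (c : 'I_2 -> 'I_2) :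
  s * s = 1 -> strictly_convex (fun x => s * u x) ->
  {homo r : i j / (i < j)%N} -> {homo c : i j / (i < j)%N} ->
  L1Q (fun x => \det (mxsub r c (normal_jacobian u x))).
Proof.
move=> ss; set v := fun x => s * u x => sv hr hc.
have s1 : `|s| = 1.
  have /eqP : `|s| ^+ 2 = 1 by rewrite -normrX expr2 ss normr1.
  by rewrite sqrp_eq1// => /eqP.
have uE x : u x = s * v x by rewrite /v mulrA ss mul1r.
have cv x : Q x -> forall eps : R, 0 < eps -> exists2 d : R, 0 < d &
    forall y, Q y -> ball x d y -> `|v y - v x| < eps.
  move=> Qx eps /(within_continuous_dist Qx)[d d0 hd].
  by exists d => // y Qy xy; rewrite /v -mulrBr normrM s1 mul1r; exact: hd.
pose scale (p : R * R) : R * R := (s * p.1, s * p.2).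
have scaleK p : scale (scale p) = p.
  by rewrite /scale /= !mulrA ss !mul1r -surjective_pairing.
have mscale : measurable_fun setT (scale : plane R -> plane R).
  by apply: measurable_fun_pair; apply: measurable_funM => //;
    first [exact: measurable_fst2|exact: measurable_snd2].
have mS := measurable_smooth_set cv.
have SQ x : smooth_set v x -> Q x by move=> /smooth_set_open; exact: open_square_subQ.
apply: (@normal_minor_L1Q R u (smooth_set v) (fun x => scale (convex_grad v x))
  (fun p => argmin v (scale p)) mS _ _ _ _ _ _ _ _ _ r c hr hc).
- exact: smooth_set_open.
- exact: leb2_not_smooth.
- by apply: measurable_funS (measurable_on_Q within_continuous_dist) => //; exact: measurable_Q.
- move=> x Sx e e0; have [d d0 hd] := within_continuous_dist (SQ _ Sx) e0.
  by exists d => // y Sy; apply: hd; exact: SQ.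
- have m1 : measurable_fun (smooth_set v) (slope_along v (1, 0) : plane R -> R).
    apply: measurable_funS (measurable_slope_along cv sv _ _) => [||/=|/=].
    + exact: measurable_differentiable_along.
    + by move=> x [].
    + by rewrite normr1.
    + by rewrite normr0.
  have m2 : measurable_fun (smooth_set v) (slope_along v (0, 1) : plane R -> R).
    apply: measurable_funS (measurable_slope_along cv sv _ _) => [||/=|/=].
    + exact: measurable_differentiable_along.
    + by move=> x [].
    + by rewrite normr0.
    + by rewrite normr1.
  have /(measurable_restrictT _ mS) n1 := m1.
  have /(measurable_restrictT _ mS) n2 := m2.
  apply: (@eq_measurable_fun _ _ (plane R) (plane R) _
    (scale \o (fun x => ((slope_along v (1, 0) \_ (smooth_set v)) x,
                         (slope_along v (0, 1) \_ (smooth_set v)) x)))) => [x xS|].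
    by rewrite /= !patchE xS.
  by apply: measurable_funTS; exact: (measurableT_comp mscale (measurable_fun_pair n1 n2)).
- move=> x Sx e e0.
  have [d1 d10 h1] := convex_grad_continuous_along cv sv Sx (or_introl erefl) e0.
  have [d2 d20 h2] := convex_grad_continuous_along cv sv Sx (or_intror erefl) e0.
  exists (Num.min d1 d2); first by rewrite lt_min d10.
  move=> y Sy xy; split; rewrite /ball/= -mulrBr normrM s1 mul1r distrC.
    by apply: h1 => //; apply: le_ball xy; rewrite ge_min lexx.
  by apply: h2 => //; apply: le_ball xy; rewrite ge_min lexx orbT.
- move=> x Sx eps eps0.
  have [d d0 hd] := convex_grad_differentiable sv Sx eps0.
  exists d => // y /hd[_]; rewrite !uE.
  have -> : s * v y - s * v x - lin (scale (convex_grad v x)) x y =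
    s * (v y - v x - lin (convex_grad v x) x y) by rewrite /lin /scale /=; ring.
  by rewrite normrM s1 mul1r.
- exact: (measurableT_comp (measurable_argmin cv sv) mscale).
- by move=> x Sx; rewrite scaleK argmin_grad.
Qed.

End StrictlyConvex.

(* r and c select the rows and the columns of the minor. *)
Theorem proposition5p7 (R : realType) (u : R * R -> R)
  (cu : {within Q, continuous u})
  (Eu : (relaxed_energy u < +oo)%E)
  (su : strictly_convex u \/ strictly_convex (fun x => - u x))
  (r : 'I_2 -> 'I_3) (c : 'I_2 -> 'I_2)
  (hr : {homo r : i j / (i < j)%N}) (hc : {homo c : i j / (i < j)%N}) :
  L1Q (fun x => \det (mxsub r c (normal_jacobian u x))).
Proof.
case: su => su.
  apply: (strictly_convex_minor_L1Q cu (s := 1)) => //; first by rewrite mulr1.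
  by under eq_fun do rewrite mul1r.
apply: (strictly_convex_minor_L1Q cu (s := -1)) => //; first by rewrite mulrNN mulr1.
by under eq_fun do rewrite mulN1r.
Qed.
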